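(* There are exactly $9$ monic Littlewood polynomials $P(X)$ of degree at most $12$ that divide (in $\mathbb{Z}[X]$) some Newman polynomial and are not products of cyclotomic polynomials.
   Context: A Littlewood polynomial is a polynomial $\sum_{j=0}^d a_jX^j\in\mathbb{Z}[X]$ with all coefficients $a_j\in\{-1,1\}$. A Newman polynomial is a polynomial in $\mathbb{Z}[X]$ with all coefficients in $\{0,1\}$ and constant term $1$. *)

(* Defs.v *)
From mathcomp Require Import all_boot all_order all_algebra all_field.
Set Implicit Arguments.
Unset Strict Implicit.
Unset Printing Implicit Defensive.
Import GRing.Theory.
Local Open Scope ring_scope.

(* The coefficients of P are the entries of its coefficient sequence, from the
   constant term up to the (nonzero) leading one; [P != 0] excludes the empty
   sequence. *)
Definition littlewood (P : {poly int}) : bool :=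
  (P != 0) && all (fun a => a \in [:: -1; 1]) P.

Definition newman (N : {poly int}) : bool :=
  (N`_0 == 1) && all (fun a => a \in [:: 0; 1]) N.

(* Spelled out because [%|] on {poly int} is pseudo-divisibility, which ignores
   integer content. *)
Definition zdvdp (P N : {poly int}) : Prop := exists Q : {poly int}, N = Q * P.

(* Factors may be repeated, and the empty product 1 is allowed. *)
Definition is_cyclotomic_product (P : {poly int}) : Prop :=
  exists2 s : seq nat, all (leq 1) s & P = \prod_(n <- s) 'Phi_n.

(* Main.v *)
(* Let N = 1 + a_1 x + a_2 x^2 + ... be a Newman polynomial divisible by P.  A
   Newman polynomial is positive on [0, +oo), so P has no nonnegative root.  If
   g is a root of P with |g| < 1, then for every complex w the numbers
   Re (w a_j g^j) sum to 0; this fails as soon as, for some prefix a_0 .. a_(k-1),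
   sum_(j < k) a_j Re (w g^j) exceeds the sum over j >= k of the negative parts
   of Re (w g^j).  Splitting on the digits a_1, a_2, ... and using at each leaf
   a suitable root g and direction w, a finite binary tree shows that no Newman
   polynomial vanishes at all the chosen roots.  Such a tree exists for every
   monic Littlewood polynomial of degree at most 12, up to reversal of the
   coefficients, unless it has a nonnegative root, is a product of cyclotomic
   polynomials, or is one of nine polynomials.  Each of these nine has an
   explicit Newman multiple, and a root of modulus less than 1. *)

From Stdlib Require Import ZArith.
Require Import Defs.
From mathcomp Require Import all_boot all_order all_algebra.
From mathcomp Require Import all_field.
From mathcomp Require Import zify ssrZ ring.
Import Order.TTheory GRing.Theory Num.Theory.
Set Implicit Arguments.
Unset Strict Implicit.
Unset Printing Implicit Defensive.
(* The key %Z is taken by MathComp's int_scope. *)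
Delimit Scope Z_scope with BZ.
Local Open Scope ring_scope.

(** * The certificate checker *)

(** The obstacle is to make estimates at algebraic numbers checkable by evaluation. A root enters
    only through a Gaussian integer close to S g, S = 2^p; every numerical fact becomes an
    inequality between integers, with rounding errors written out. Each estimate holds on the whole
    disc around the approximation, so it is enough that some root lies in that disc, and the origin
    of the approximations, directions and trees is irrelevant to soundness. Convergence of the tails
    forces |g| < 1. Roots outside the unit circle are reached through the reversed polynomial:
    reversal sends Newman polynomials to Newman polynomials and inverts roots. The same symmetry
    nearly halves the enumeration of the 8191 sign words, provided that all three outcomes of the
    classification are stable under reversal; this is why the exceptional words are checked to be
    palindromes. On the cyclotomic side a certificate shows only that all roots are roots of unity;
    the factors are then split off one at a time. *)

Inductive gauss := G (re im : Z).

(* With precision p, the Gaussian integer x + i y stands for (x + i y) / 2^p;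
   [radius] bounds, in the same unit, the distance to the root that it
   approximates. *)
Definition scale (p : Z) : Z := Z.shiftl 1 p.
Definition radius : Z := 16.

Definition gauss_mul (x y : gauss) : gauss :=
  let: G a b := x in let: G c d := y in
  G (a * c - b * d)%BZ (a * d + b * c)%BZ.

Definition gauss_norm (x : gauss) : Z := let: G a b := x in (a * a + b * b)%BZ.

(* S^n, S^n P(x) and S^n P'(x), where x = z / S, S = 2^p and n = size s. *)
Fixpoint taylor (p : Z) (z : gauss) (s : seq Z) : Z * gauss * gauss :=
  if s is c :: s' then
    let: (pw, h, D) := taylor p z s' in
    let: G h1 h2 := h in
    let: G zh1 zh2 := gauss_mul z h in
    let: G zD1 zD2 := gauss_mul z D in
    (Z.shiftl pw p, G (Z.shiftl (c * pw) p + zh1)%BZ zh2,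
     G (Z.shiftl h1 p + zD1)%BZ (Z.shiftl h2 p + zD2)%BZ)
  else (1%BZ, G 0 0, G 0 0).

(* Newton's bound n |P(x)| <= e |P'(x)| forces a root within e of x, since
   P'/P is the sum of the 1/(x - a) over the roots a. *)
Definition near_root (p : Z) (s : seq Z) (z : gauss) : bool :=
  let: (_, h, D) := taylor p z s in
  let k := (Z.of_nat (size s) * scale p)%BZ in
  (k * k * gauss_norm h <=? radius * radius * gauss_norm D)%BZ.

(* Successive pairs (c, e) with |S g^k - c| <= e, for any g in the disc around z;
   r bounds S |g|^k and m bounds S |g|.  The second component bounds the first
   power that is left out. *)
Fixpoint powers (p : Z) (fuel : nat) (z : gauss) (m : Z) (c : gauss) (e r : Z) :
    seq (gauss * Z) * Z :=
  if fuel is fuel'.+1 then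
    (* For p >= 10 this says r S / (S - m) < 2^10: the geometric tail that would be left out is then
       below 2^10 units, that is 2^(10 - p). *)
    if (Z.shiftl r (p - 10) <? scale p - m)%BZ then ([::], r) else
    let: G x y := gauss_mul c z in
    let: (l, t) := powers p fuel' z m (G (Z.shiftr x p) (Z.shiftr y p))
      (Z.shiftr (m * e + (r + e) * radius) p + 3)%BZ (Z.shiftr (r * m) p + 1)%BZ in
    ((c, e) :: l, t)
  else ([::], r).

(** Bounds S |g| for every g in the disc around z; the 1 makes up for the integer square root, which
    rounds down. *)
Definition modulus_bound (z : gauss) : Z :=
  (Z.sqrt (gauss_norm z) + 1 + radius)%BZ.

(** The second component bounds the geometric tail S |g|^k / (1 - |g|), k being the number of powers
    listed; the final 1 absorbs the rounding of the division. *)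
Definition root_data (p : Z) (z : gauss) : seq (gauss * Z) * Z :=
  let m := modulus_bound z in
  let: (l, t) := powers p 200 z m (G (scale p) 0) 0 (scale p) in
  (l, (t * scale p / (scale p - m) + 1)%BZ).

(* A lower bound for the sum of the Re (w a_j g^j) covered by l, over all 0/1
   sequences with prefix a. *)
Fixpoint lower_sum (w : gauss) (a : seq bool) (l : seq (gauss * Z)) : Z :=
  if l is (G x y, e) :: l' then
    let: G u v := w in
    let lo := (u * x - v * y - (Z.abs u + Z.abs v) * e)%BZ in
    match a with
    | [::] => (Z.min 0 lo + lower_sum w [::] l')%BZ
    | true :: a' => (lo + lower_sum w a' l')%BZ
    | false :: a' => lower_sum w a' l'
    end
  else 0%BZ.

(* A node branches on the next digit of N; a leaf gives the index of a root and
   the direction u + i v that exclude the current prefix. *)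
Inductive tree := Leaf (i : nat) (u v : Z) | Node (t0 t1 : tree).

(** The prefix [a] is stored with its latest digit first. A leaf whose index is out of range falls
    back on the default data, where the test reads 0 < 0 and fails. *)
Fixpoint tree_ok (rs : seq (seq (gauss * Z) * Z)) (t : tree) (a : seq bool) :
    bool :=
  match t with
  | Leaf i u v =>
    let: (l, T) := nth ([::], 0%BZ) rs i in
    ((Z.abs u + Z.abs v) * T <? lower_sum (G u v) (rev a) l)%BZ
  | Node t0 t1 => tree_ok rs t0 (false :: a) && tree_ok rs t1 (true :: a)
  end.

(** The tree starts from the prefix [[:: true]] because the constant term of a Newman polynomial is
    1. The bound on [modulus_bound] places the roots in the open unit disc. *)
Definition no_newman_multiple (p : Z) (s : seq Z) (zs : seq gauss) (t : tree) : bool :=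
  [&& (0 <=? p)%BZ,
      all (fun z => near_root p s z && (modulus_bound z <? scale p)%BZ) zs &
      tree_ok (map (root_data p) zs) t [:: true]].

(** Horner's rule cleared of denominators: for nonempty s of size n the result is y^n and y^(n-1)
    P(x / y). *)
Fixpoint real_value (x y : Z) (s : seq Z) : Z * Z :=
  if s is c :: s' then
    let: (pw, h) := real_value x y s' in ((y * pw)%BZ, (c * pw + x * h)%BZ)
  else (1%BZ, 0%BZ).

(* P(x / 20) <= 0. *)
Definition nonpos_at (s : seq Z) (x : Z) : bool :=
  let: (_, h) := real_value x 20 s in (h <=? 0)%BZ.
(** A monic sign polynomial is positive at 2, so a value <= 0 at one of these sample points of
    [0, 1] yields a root in [0, 2]. The point 0 catches every word with constant term -1. *)
Definition positive_root (s : seq Z) : bool :=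
  (last 0%BZ s =? 1)%BZ && has (nonpos_at s) [:: 0; 14; 15; 16; 17; 20]%BZ.

Fixpoint add (s t : seq Z) : seq Z :=
  match s, t with
  | [::], _ => t
  | _, [::] => s
  | a :: s', b :: t' => (a + b)%BZ :: add s' t'
  end.

Fixpoint conv (s t : seq Z) : seq Z :=
  if s is c :: s' then add (map (Z.mul c) t) (0%BZ :: conv s' t) else [::].

Definition xn_sub_1 (n : nat) : seq Z := (-1)%BZ :: rcons (nseq n.-1 0%BZ) 1%BZ.

Definition mul_xn_sub_1 (ns : seq nat) (s : seq Z) : seq Z :=
  foldr (fun n => conv (xn_sub_1 n)) s ns.

(* P times the product of the x^n - 1, n in a, is the product of the x^n - 1,
   n in b. *)
Definition cyclotomic_quotient (s : seq Z) (a b : seq nat) : bool :=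
  all (leq 1) b && (mul_xn_sub_1 a s == mul_xn_sub_1 b [:: 1%BZ]).

(* Only serves to choose one polynomial in each pair of reversals. *)
Definition code (s : seq Z) : Z :=
  foldr (fun c v => c + 3 * v)%BZ 0%BZ s.

(* [Dir] and [DirT] use roots of P, [Rec] and [RecT] roots of its reversal; the
   T forms carry a tree instead of a single direction. *)
Inductive cert :=
  | Cyc (a b : seq nat)
  | Exc
  | Dir (p x y u v : Z)
  | Rec (p x y u v : Z)
  | DirT (p : Z) (zs : seq gauss) (t : tree)
  | RecT (p : Z) (zs : seq gauss) (t : tree).

(* An exceptional polynomial, its cofactor in a Newman multiple, and a root of
   modulus less than 1, with precision 20. *)
Definition exceptional_data : seq (seq Z * seq Z * gauss) := [::
([:: 1; 1; -1; 1; 1; -1; 1; 1],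
 [:: 1; 0; 1; -1; 1; -1; 1; -1; 1; 0; 1],
 G (-662671) 0);
([:: 1; 1; -1; -1; 1; -1; -1; 1; 1],
 [:: 1; 0; 1; 0; 1; 1; 1; 1; 0; 1; 0; 1],
 G (-703817) 366180);
([:: 1; 1; 1; -1; -1; -1; -1; 1; 1; 1],
 [:: 1; 0; 0; 1; 1; 0; 1; 0; 1; 1; 0; 0; 1],
 G (-430815) 659742);
([:: 1; 1; -1; -1; -1; 1; 1; 1; -1; -1; -1; 1; 1],
 [:: 1; 0; 1; 1; 1; 1; 1; 1; 1; 1; 1; 1; 1; 1; 0; 1],
 G (-649193) 0);
([:: 1; 1; -1; -1; -1; 1; 1],
 [:: 1; 0; 1; 1; 1; 1; 1; 1; 0; 1],
 G (-673879) 0);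
([:: 1; 1; 1; -1; -1; -1; -1; -1; 1; 1; 1],
 [:: 1; 0; 0; 1; 0; 1; 1; 0; 1; 1; 1; 1; 1; 1; 1; 1; 1; 1; 0; 1; 1; 0; 1; 0;
     0; 1],
 G (-367520) 707091);
([:: 1; -1; 1; 1; -1; 1; -1; 1; 1; -1; 1],
 [:: 1; 1; 1; 0; 0; -1; 0; 0; 0; -1; 0; 0; 1; 1; 1],
 G (367520) 707091);
([:: 1; 1; 1; -1; -1; -1; 1; -1; -1; -1; 1; 1; 1],
 [:: 1; 0; 0; 1; 0; 0; 1; 1; 0; 1; 1; 0; 1; 1; 1; 1; 1; 1; 0; 1; 1; 0; 1; 1;
     0; 0; 1; 0; 0; 1],
 G (-771943) 576959);
([:: 1; -1; 1; 1; -1; 1; 1; 1; -1; 1; 1; -1; 1],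
 [:: 1; 1; 1; 0; -1; -1; -1; -1; 0; 1; 2; 2; 1; 0; -1; -2; -2; -1; 0; 2; 2; 2;
     1; 0; -2; -2; -2; 0; 1; 2; 2; 2; 0; -1; -2; -2; -1; 0; 1; 2; 2; 1; 0; -1;
     -1; -1; -1; 0; 1; 1; 1],
 G (771943) 576959)].

Definition exceptions : seq (seq Z) := [seq x.1.1 | x <- exceptional_data].

Definition cert_ok (s : seq Z) (c : cert) : bool :=
  match c with
  | Cyc a b => cyclotomic_quotient s a b
  | Exc => s \in exceptions
  | Dir p x y u v => no_newman_multiple p s [:: G x y] (Leaf 0 u v)
  | Rec p x y u v => no_newman_multiple p (rev s) [:: G x y] (Leaf 0 u v)
  | DirT p zs t => no_newman_multiple p s zs t
  | RecT p zs t => no_newman_multiple p (rev s) zs t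
  end.

(** When the constant term is 1 the reversal is again a monic word, and the member of the pair with
    the smaller code stands for both. *)
Definition skipped (s : seq Z) : bool :=
  [|| (head 0%BZ s =? 1)%BZ && (code (rev s) <? code s)%BZ, positive_root s
    | positive_root (rev s)].

(** Skipped words consume no certificate, so the certificates are matched in order with the
    remaining words. *)
Fixpoint certified (ss : seq (seq Z)) (cs : seq cert) : bool :=
  match ss, cs with
  | [::], _ => true
  | s :: ss', _ => if skipped s then certified ss' cs else
      if cs is c :: cs' then cert_ok s c && certified ss' cs' else false
  end.

Definition sign_word (s : seq Z) := all (fun c => c \in [:: 1; -1]%BZ) s.

(** The test [rev s == s] makes the exceptional list stable under reversal. The root near z has
    modulus less than 1, hence is not a root of unity. *)
Definition exceptional_ok (x : seq Z * seq Z * gauss) : bool :=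
  let: (s, q, z) := x in
  [&& sign_word s, rev s == s, last 0%BZ s == 1%BZ, (size s <= 13)%N,
      near_root 20 s z, (modulus_bound z <? scale 20)%BZ,
      head 0%BZ (conv q s) == 1%BZ &
      all (fun c => c \in [:: 0; 1]%BZ) (conv q s)].

Fixpoint sign_words (n : nat) : seq (seq Z) :=
  if n is n'.+1 then
    map (cons 1%BZ) (sign_words n') ++ map (cons (-1)%BZ) (sign_words n')
  else [:: [::]].

Definition monic_words : seq (seq Z) :=
  flatten [seq [seq rcons w 1%BZ | w <- sign_words d] | d <- iota 0 13].

(** * Roots from approximations *)

Definition ZtoC (x : Z) : algC := (int_of_Z x)%:~R.

Lemma ZtoCD x y : ZtoC (x + y)%BZ = ZtoC x + ZtoC y.
Proof. by rewrite /ZtoC -rmorphD -rmorphD. Qed.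
Lemma ZtoCM x y : ZtoC (x * y)%BZ = ZtoC x * ZtoC y.
Proof. by rewrite /ZtoC -rmorphM -rmorphM. Qed.
Lemma ZtoCN x : ZtoC (- x)%BZ = - ZtoC x.
Proof. by rewrite /ZtoC -rmorphN -rmorphN. Qed.
Lemma ZtoCB x y : ZtoC (x - y)%BZ = ZtoC x - ZtoC y.
Proof. by rewrite -Z.add_opp_r ZtoCD ZtoCN. Qed.
Lemma ZtoC0 : ZtoC 0 = 0. Proof. by []. Qed.
Lemma ZtoC_real x : ZtoC x \is Num.real.
Proof. exact: realz. Qed.
Lemma ZtoC_le x y : (x <= y)%BZ -> ZtoC x <= ZtoC y.
Proof. by move=> le_xy; rewrite /ZtoC ler_int; lia. Qed.
Lemma ZtoC_lt x y : (x < y)%BZ -> ZtoC x < ZtoC y.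
Proof. by move=> lt_xy; rewrite /ZtoC ltr_int; lia. Qed.
Lemma ZtoC_ge0 x : (0 <= x)%BZ -> 0 <= ZtoC x.
Proof. exact: ZtoC_le 0%BZ x. Qed.
Lemma ZtoC_abs x : ZtoC (Z.abs x) = `|ZtoC x|.
Proof.
case: (Z.abs_spec x) => -[x0 ->]; first by rewrite ger0_norm ?ZtoC_ge0.
by rewrite ZtoCN ltr0_norm // -ZtoC0 ZtoC_lt.
Qed.

Definition gval (z : gauss) : algC := let: G a b := z in ZtoC a + 'i * ZtoC b.

Lemma gval_mul x y : gval (gauss_mul x y) = gval x * gval y.
Proof.
case: x y => [a b] [c d] /=; rewrite !(ZtoCD, ZtoCB, ZtoCM).
have := @sqrCi algC; set i := 'i => ii.
(* For [ring] the imaginary unit is an indeterminate, so the sign is first written as i^2. *)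
have -> : ZtoC a * ZtoC c - ZtoC b * ZtoC d = ZtoC a * ZtoC c + i ^+ 2 * (ZtoC b * ZtoC d).
  by rewrite ii mulN1r.
ring.
Qed.

Lemma gval_norm z : `|gval z| ^+ 2 = ZtoC (gauss_norm z).
Proof. by case: z => a b /=; rewrite normC2_rect ?ZtoC_real // ZtoCD !ZtoCM. Qed.

Lemma gval_re a b : 'Re (gval (G a b)) = ZtoC a.
Proof. by rewrite /= Re_rect ?ZtoC_real. Qed.

Lemma gval_norm_le u v : `|gval (G u v)| <= ZtoC (Z.abs u + Z.abs v)%BZ.
Proof.
by rewrite /= (le_trans (ler_normD _ _)) // normrM normCi mul1r ZtoCD !ZtoC_abs.
Qed.

Lemma scale_gt0 p : (0 <= p)%BZ -> (0 < scale p)%BZ.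
Proof. by move=> p0; rewrite /scale Z.shiftl_1_l; apply: Z.pow_pos_nonneg. Qed.

Lemma shiftl_scale p x : (0 <= p)%BZ -> Z.shiftl x p = (scale p * x)%BZ.
Proof. by move=> p0; rewrite /scale !Z.shiftl_mul_pow2 //; ring. Qed.

Lemma shiftr_bounds p x : (0 <= p)%BZ ->
  (scale p * Z.shiftr x p <= x < scale p * Z.shiftr x p + scale p)%BZ.
Proof.
move=> p0; rewrite Z.shiftr_div_pow2 // /scale Z.shiftl_1_l.
have := Z.pow_pos_nonneg 2 p ltac:(lia) p0.
move=> H; have := Z_div_mod_eq_full x (2 ^ p).
by have := Z.mod_pos_bound x (2 ^ p) H; lia.
Qed.

(** By contraposition: if all roots are farther than e from z, the logarithmic derivative at z is
    smaller than n / e in modulus. The inequality is kept in product form, which lets it pass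
    through an induction on the list of roots. *)
Lemma near_root_of_deriv (rs : seq algC) (p : {poly algC}) (z e : algC) n :
  p = \prod_(a <- rs) ('X - a%:P) -> (size rs <= n)%N -> (0 < size rs)%N ->
  0 <= e -> n%:R * `|p.[z]| <= e * `|p^`().[z]| ->
  exists2 a, root p a & `|a - z| <= e.
Proof.
move=> -> le_n rs_gt0 e_ge0 le_pd.
case: (boolP (has (fun a => `|a - z| <= e) rs)) => [/hasP[a a_rs le_az]|].
  by exists a => //; rewrite root_prod_XsubC.
move/hasPn => far; exfalso.
have {far} : forall a, a \in rs -> e < `|z - a|.
  by move=> a /far; rewrite -real_ltNge ?ger0_real // distrC.
move=> far.
(* For the empty product both sides are 0, so strictness starts with the first factor; the weak
   inequality is what the induction carries through the empty case. *)
have strict : forall s : seq algC, (forall a, a \in s -> e < `|z - a|) ->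
    let q := \prod_(a <- s) ('X - a%:P) in
    [/\ q.[z] != 0, e * `|q^`().[z]| <= (size s)%:R * `|q.[z]| &
        (0 < size s)%N -> e * `|q^`().[z]| < (size s)%:R * `|q.[z]|].
  elim=> [|a s IHs] far_s /=.
    by rewrite big_nil derivC horner0 hornerC normr0 mulr0 mul0r oner_eq0.
  have [|q0 le_q _] := IHs; first by move=> b b_s; apply: far_s; rewrite in_cons b_s orbT.
  have fa : e < `|z - a| by apply: far_s; rewrite mem_head.
  have za : 0 < `|z - a| by apply: le_lt_trans fa.
  rewrite big_cons; set q := \prod_(j <- s) _ in q0 le_q *.
  rewrite derivM derivXsubC mul1r hornerD !hornerM hornerXsubC.
  suff lt_q : e * `|q.[z] + (z - a) * q^`().[z]| < (size s).+1%:R * `|(z - a) * q.[z]|.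
    by split; rewrite ?(ltW lt_q) // mulf_neq0 // -normr_gt0.
  apply: (@le_lt_trans _ _ (e * `|q.[z]| + `|z - a| * ((size s)%:R * `|q.[z]|))).
    rewrite (le_trans (ler_wpM2l e_ge0 (ler_normD _ _))) // mulrDr lerD2l normrM.
    by rewrite mulrCA ler_wpM2l.
  rewrite normrM -natr1 mulrDl mul1r [X in _ < X + _]mulrCA addrC ltrD2l.
  by rewrite ltr_pM2r // normr_gt0.
have [p0 _ /(_ rs_gt0) lt_q] := strict _ far.
have := le_lt_trans le_pd lt_q; rewrite ltr_pM2r ?normr_gt0 // ltr_nat.
by rewrite ltnNge le_n.
Qed.

Lemma root_near (p : {poly algC}) (z e : algC) n :
  p != 0 -> (size p <= n)%N -> 0 <= e ->
  n%:R * `|p.[z]| <= e * `|p^`().[z]| ->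
  exists2 a, root p a & `|a - z| <= e.
Proof.
move=> p0 le_pn e0; have [rs Dp] := closed_field_poly_normal p.
have c0 : lead_coef p != 0 by rewrite lead_coef_eq0.
have size_rs : (size rs < n)%N.
  by move: le_pn; rewrite {1}Dp size_scale // size_prod_XsubC.
rewrite {1 2}Dp derivZ !hornerZ !normrM ![_ * (`|lead_coef p| * _)]mulrCA.
rewrite ler_pM2l ?normr_gt0 // => le_pd.
(* A nonzero constant has zero derivative, and the bound would then force n = 0. *)
have rs_gt0 : (0 < size rs)%N.
  rewrite lt0n; apply/negP => /nilP rs0; move: le_pd size_rs.
  rewrite rs0 big_nil derivC horner0 hornerC normr0 mulr0 normr1 mulr1 lern0 => /eqP->.
  by rewrite ltn0.
have [a ra le_a] := near_root_of_deriv (erefl _) (ltnW size_rs) rs_gt0 e0 le_pd.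
by exists a => //; rewrite Dp rootZ.
Qed.

Definition cpoly (s : seq Z) : {poly algC} := Poly (map ZtoC s).

Lemma cpoly_nil : cpoly [::] = 0.
Proof. by rewrite /cpoly -[RHS]polyseqK polyseq0. Qed.

Lemma cpoly_cons c s : cpoly (c :: s) = cpoly s * 'X + (ZtoC c)%:P.
Proof. by rewrite /cpoly /= cons_poly_def. Qed.

Section Precision.
Variables (p : Z) (p_ge0 : (0 <= p)%BZ).
Let S := ZtoC (scale p).

Lemma S_gt0 : 0 < S.
Proof. by rewrite -ZtoC0; apply/ZtoC_lt/scale_gt0. Qed.
Hint Resolve S_gt0 : core.

Lemma S_neq0 : S != 0. Proof. by rewrite gt_eqF. Qed.

Lemma ZtoC_shiftl x : ZtoC (Z.shiftl x p) = S * ZtoC x.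
Proof. by rewrite shiftl_scale // ZtoCM. Qed.

Lemma ZtoC_shiftr x : S * ZtoC (Z.shiftr x p) <= ZtoC x < S * ZtoC (Z.shiftr x p) + S.
Proof.
have [le_x lt_x] := shiftr_bounds x p_ge0.
by rewrite -ZtoCM -ZtoCD ZtoC_le // ZtoC_lt.
Qed.

Lemma taylorP z s :
  let: (pw, h, D) := taylor p z s in
  let x := gval z / S in
  [/\ ZtoC pw = S ^+ size s, gval h = S ^+ size s * (cpoly s).[x] &
      gval D = S ^+ size s * (cpoly s)^`().[x]].
Proof.
elim: s => [|c s] /=.
  by rewrite cpoly_nil linear0 !horner0 !expr0 ZtoC0 !mulr0 addr0.
case: (taylor p z s) => -[pw [h1 h2]] [D1 D2].
case Ezh: (gauss_mul z (G h1 h2)) => [zh1 zh2].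
case EzD: (gauss_mul z (G D1 D2)) => [zD1 zD2] [Epw Eh ED].
have S0 := S_neq0.
have := gval_mul z (G h1 h2); rewrite Ezh Eh => Eh'.
have := gval_mul z (G D1 D2); rewrite EzD ED => ED'.
rewrite cpoly_cons derivD derivM derivC derivX mulr1 addr0 !hornerE.
rewrite /= in Eh Eh' ED ED' *.
have sE : S ^+ (size s).+1 = S * S ^+ size s by rewrite exprS.
split; first by rewrite ZtoC_shiftl Epw.
- rewrite !ZtoCD ZtoC_shiftl ZtoCM Epw -addrA Eh' sE.
  rewrite mulrDr addrC; congr (_ + _); last by rewrite [ZtoC c * _]mulrC mulrA.
  by rewrite [in RHS]mulrA mulrCA mulrAC; field.
- rewrite !ZtoCD !ZtoC_shiftl mulrDr addrACA ED' mulrCA -mulrDr Eh sE.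
  by rewrite mulrDr addrC; congr (_ + _); [field | rewrite mulrA].
Qed.

Lemma near_rootP s z : near_root p s z -> cpoly s != 0 ->
  exists2 g, root (cpoly s) g & `|S * g - gval z| <= ZtoC radius.
Proof.
have := taylorP z s; rewrite /near_root.
case: (taylor p z s) => -[pw h] D [_ Eh ED] /Z.leb_le/ZtoC_le.
have S0 := S_neq0; have S1 := S_gt0.
rewrite !ZtoCM -!gval_norm Eh ED => le_hD s0.
have size_ZtoC : ZtoC (Z.of_nat (size s)) = (size s)%:R.
  rewrite /ZtoC (_ : int_of_Z _ = (size s)%:Z) //; lia.
have radius_ge0 : 0 <= ZtoC radius by apply: ZtoC_ge0.
have [|||g rg le_g] := @root_near (cpoly s) (gval z / S) (ZtoC radius / S) (size s) s0.
- by rewrite (leq_trans (size_Poly _)) // size_map.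
- by rewrite divr_ge0 // ltW.
- rewrite size_ZtoC -!expr2 -!exprMn ler_pXn2r ?nnegrE ?mulr_ge0 ?(ltW S1) // in le_hD.
  move: le_hD; set P := (cpoly s).[_]; set P' := _.[_]; set n := _%:R.
  rewrite !normrM mulrAC.
  set c := `|S ^+ _|; have c_gt0 : 0 < c by rewrite normr_gt0 expf_neq0.
  have -> : n * (c * `|P|) * S = c * (n * S * `|P|) by ring.
  have -> : ZtoC radius * (c * `|P'|) = c * (ZtoC radius * `|P'|) by ring.
  rewrite ler_pM2l // => le_PP.
  by rewrite mulrAC ler_pdivlMr // mulrAC.
exists g => //; have -> : S * g - gval z = S * (g - gval z / S) by field.
by rewrite normrM gtr0_norm // -ler_pdivlMl // [leRHS]mulrC.
Qed.
End Precision.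

(** * Excluding Newman multiples *)

Lemma Re_lower (x : algC) : - `|x| <= 'Re x.
Proof.
have [le_Re _] := leif_normC_Re_Creal x; apply: le_trans (_ : - `|'Re x| <= _).
  by rewrite lerN2.
by rewrite lerNl; apply: le_trans (real_ler_norm _) _; rewrite ?normrN ?rpredN ?Creal_Re.
Qed.

(** The digit list b is read as if followed by zeros, hence the default [false]; the prefix a may be
    longer than b, since a branch of the tree may go beyond the degree of N. *)
Fixpoint agree (a b : seq bool) : Prop :=
  if a is x :: a' then head false b = x /\ agree a' (behead b) else True.

Lemma agree_rcons a x b :
  agree a b -> nth false b (size a) = x -> agree (rcons a x) b.
Proof.
elim: a b => [|y a IHa] b /=; first by rewrite nth0.
by case=> Dy ab nb; split=> //; apply: IHa => //; rewrite nth_behead.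
Qed.

Section Enclosure.
Variables (p : Z) (p_ge0 : (0 <= p)%BZ) (z : gauss) (g : algC).
Let S := ZtoC (scale p).
Hypothesis near_z : `|S * g - gval z| <= ZtoC radius.
Hypothesis small_z : (modulus_bound z < scale p)%BZ.

Lemma modulus_boundP : S * `|g| <= ZtoC (modulus_bound z).
Proof.
have S0 := S_gt0 p_ge0; have -> : S * `|g| = `|S * g| by rewrite normrM gtr0_norm.
rewrite -[S * g](subrK (gval z)) (le_trans (ler_normD _ _)) //.
rewrite /modulus_bound ZtoCD addrC lerD //.
have n0 : (0 <= gauss_norm z)%BZ by case: (z) => a b /=; nia.
have [_ lt_n] := Z.sqrt_spec _ n0.
rewrite -(@ler_pXn2r _ 2) ?nnegrE ?normr_ge0 ?ZtoC_ge0 //; last first.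
  by have := Z.sqrt_nonneg (gauss_norm z); lia.
by rewrite gval_norm expr2 -ZtoCM ZtoC_le //; lia.
Qed.

Lemma g_lt1 : `|g| < 1.
Proof.
rewrite -(ltr_pM2l (S_gt0 p_ge0)) mulr1.
exact: le_lt_trans modulus_boundP (ZtoC_lt small_z).
Qed.

Fixpoint enclose (k : nat) (l : seq (gauss * Z)) : Prop :=
  if l is (c, e) :: l' then
    `|S * g ^+ k - gval c| <= ZtoC e /\ enclose k.+1 l'
  else True.

Lemma powersP fuel c e r k :
  `|S * g ^+ k - gval c| <= ZtoC e -> S * `|g| ^+ k <= ZtoC r ->
  let: (l, t) := powers p fuel z (modulus_bound z) c e r in
  enclose k l /\ S * `|g| ^+ (k + size l) <= ZtoC t.
Proof.
elim: fuel c e r k => [|fuel IHfuel] c e r k ge_c le_r /=; first by rewrite addn0.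
case: Z.ltb; first by rewrite addn0.
case Ecz: (gauss_mul c z) => [x y].
set c' := G _ _; set e' := (_ + 3)%BZ; set r' := (Z.shiftr (r * _) p + 1)%BZ.
have S0 := S_gt0 p_ge0; have le_m := modulus_boundP; set m := modulus_bound z in le_m *.
have e_ge0 : 0 <= ZtoC e by apply: le_trans ge_c.
have le_r' : S * `|g| ^+ k.+1 <= ZtoC r'.
  rewrite -(ler_pM2l S0); have [_ /ltW le_rm] := andP (ZtoC_shiftr p_ge0 (r * m)).
  rewrite /r' ZtoCD mulrDr mulr1; apply: le_trans le_rm.
  have -> : S * (S * `|g| ^+ k.+1) = S * `|g| ^+ k * (S * `|g|) by rewrite exprSr; ring.
  by rewrite ZtoCM ler_pM // mulr_ge0 ?exprn_ge0 ?(ltW S0).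
have le_e' : `|S * g ^+ k.+1 - gval c'| <= ZtoC e'.
  rewrite -(ler_pM2l S0) -{1}(gtr0_norm S0) -normrM.
  (* Three sources of error: the one inherited from the previous power, at most m e; that of the
     approximate root, at most (r + e) [radius] because |c| <= r + e; and the rounding of the
     product. *)
  have -> : S * (S * g ^+ k.+1 - gval c') =
      (S * g ^+ k - gval c) * (S * g) + gval c * (S * g - gval z)
      + (gval (G x y) - S * gval c').
    by rewrite -Ecz gval_mul exprSr; ring.
  have [_ /ltW le_X] := andP (ZtoC_shiftr p_ge0 (m * e + (r + e) * radius)).
  (* Of the 3 units added to the error, one covers the rounding of the error bound itself and two
     the rounding of the two coordinates. *)
  have -> : S * ZtoC e' = S * ZtoC (Z.shiftr (m * e + (r + e) * radius) p) + S + (S + S).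
    by rewrite /e' ZtoCD (_ : ZtoC 3 = 3%:R) //; ring.
  apply: le_trans (ler_normD _ _) _; apply: lerD.
    apply: le_trans le_X; rewrite ZtoCD !ZtoCM.
    apply: le_trans (ler_normD _ _) _; rewrite !normrM (gtr0_norm S0) mulrC; apply: lerD.
      by rewrite ler_pM ?mulr_ge0 ?(ltW S0).
    apply: ler_pM => //; rewrite ZtoCD -[gval c](subrK (S * g ^+ k)) addrC.
    apply: le_trans (ler_normD _ _) _; rewrite normrM (gtr0_norm S0) normrX lerD //.
    by rewrite distrC.
  have /andP[lox /ltW hix] := ZtoC_shiftr p_ge0 x.
  have /andP[loy /ltW hiy] := ZtoC_shiftr p_ge0 y.
  rewrite /c' /=; set x' := ZtoC (Z.shiftr x p) in lox hix *.
  set y' := ZtoC (Z.shiftr y p) in loy hiy *.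
  have -> : ZtoC x + 'i * ZtoC y - S * (x' + 'i * y') =
      (ZtoC x - S * x') + 'i * (ZtoC y - S * y') by ring.
  apply: le_trans (ler_normD _ _) _; rewrite normrM normCi mul1r.
  by rewrite !ger0_norm ?subr_ge0 // lerD // lerBlDl.
have := IHfuel c' e' r' k.+1 le_e' le_r'; rewrite -/m.
by case: (powers _ _ _ _ _ _ _) => l t [encl le_t]; rewrite /= addnS -addSn.
Qed.

Lemma root_dataP : let: (l, T) := root_data p z in
  enclose 0 l /\ S * (`|g| ^+ size l / (1 - `|g|)) <= ZtoC T.
Proof.
rewrite /root_data; set m := modulus_bound z.
have S0 := S_gt0 p_ge0; have g1 := g_lt1; have le_m := modulus_boundP.
have := @powersP 200 (G (scale p) 0) 0%BZ (scale p) 0 _ _; rewrite -/m.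
case: (powers _ _ _ _ _ _ _) => l t; rewrite add0n.
case=> [||encl le_t]; first by rewrite /= !expr0 mulr1 ZtoC0 mulr0 addr0 subrr normr0.
  by rewrite expr0 mulr1.
split=> //; have Sm : 0 < S - ZtoC m by rewrite subr_gt0 ZtoC_lt.
(* Both numerator and denominator are scaled by S so that the integer bounds t for S |g|^k and m for
   S |g| can be inserted. *)
have -> : S * (`|g| ^+ size l / (1 - `|g|)) = S * `|g| ^+ size l * S / (S - S * `|g|).
  have -> : S - S * `|g| = S * (1 - `|g|) by ring.
  by rewrite [_ * S]mulrC -mulf_div divff ?gt_eqF // mul1r mulrA.
have Sg : 0 < S - S * `|g| by apply: lt_le_trans Sm _; rewrite lerB.
have den : (0 < scale p - m)%BZ by rewrite /m; lia.
apply: (@le_trans _ _ (ZtoC t * S / (S - ZtoC m))).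
  apply: ler_pM; rewrite ?mulr_ge0 ?invr_ge0 ?exprn_ge0 ?(ltW S0) ?(ltW Sg) //.
    by rewrite ler_pM2r.
  by rewrite lef_pV2 // lerB.
rewrite ler_pdivrMr // -ZtoCB -!ZtoCM ZtoC_le //.
have := Z.mul_succ_div_gt (t * scale p) (scale p - m) den; lia.
Qed.

Definition bits (b : seq bool) : algC := foldr (fun (x : bool) v => x%:R + g * v) 0 b.

Lemma bits_behead b : bits b = (head false b)%:R + g * bits (behead b).
Proof. by case: b => //=; rewrite mulr0 addr0. Qed.

Lemma bits_norm b : `|bits b| <= (1 - `|g|)^-1.
Proof.
have g1 : 0 < 1 - `|g| by rewrite subr_gt0 g_lt1.
elim: b => [|x b IHb] /=; first by rewrite normr0 invr_ge0 ltW.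
have -> : (1 - `|g|)^-1 = 1 + `|g| * (1 - `|g|)^-1.
  have := gt_eqF g1 => /negbT; by move=> ?; field.
rewrite (le_trans (ler_normD _ _)) // lerD //; last by rewrite normrM ler_wpM2l.
by case: x; rewrite ?normr1 ?normr0.
Qed.

(** Induction on the enclosed powers, peeling off one digit of b at a time while k counts the powers
    already passed. When the list ends, the remaining digits contribute at most |w| |g|^k / (1 -
    |g|) in modulus, whatever they are; this is the term subtracted on the left. *)
Lemma lower_sumP u v l a b k : enclose k l -> agree a b ->
  ZtoC (lower_sum (G u v) a l)
    - ZtoC (Z.abs u + Z.abs v) * (S * (`|g| ^+ (k + size l) / (1 - `|g|)))
  <= S * 'Re (gval (G u v) * (g ^+ k * bits b)).
Proof.
have S0 := S_gt0 p_ge0; set W := ZtoC (Z.abs u + Z.abs v); set w := gval _.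
have le_w : `|w| <= W by apply: gval_norm_le.
have W0 : 0 <= W by apply: le_trans le_w.
elim: l a b k => [|[[x y] e] l IHl] a b k.
  rewrite /= addn0 sub0r => _ _.
  apply: le_trans (_ : S * - `|w * (g ^+ k * bits b)| <= _); last first.
    by rewrite ler_pM2l // Re_lower.
  rewrite mulrN lerN2 [leRHS]mulrCA ler_pM2l // normrM ler_pM // normrM normrX.
  by rewrite ler_wpM2l ?exprn_ge0 // bits_norm.
rewrite [lower_sum _ _ _]/=; set lo := (_ - _ * e)%BZ => -[ge_c encl] ab.
have le_lo : ZtoC lo <= S * 'Re (w * g ^+ k).
  have -> : S * 'Re (w * g ^+ k) = 'Re (w * (S * g ^+ k)).
    by rewrite -ReMl ?ZtoC_real // mulrCA.
  rewrite -[S * g ^+ k](subrK (gval (G x y))) mulrDr raddfD /= addrC /lo ZtoCB.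
  apply: lerD.
    rewrite -/(gval (G x y)) /w -gval_mul [gauss_mul _ _]/= gval_re //.
  apply: le_trans (Re_lower _); rewrite lerN2 normrM ZtoCM.
  by rewrite ler_pM.
have stepE : S * 'Re (w * (g ^+ k * bits b)) =
    (head false b)%:R * (S * 'Re (w * g ^+ k))
    + S * 'Re (w * (g ^+ k.+1 * bits (behead b))).
  rewrite bits_behead mulrDr mulrDr raddfD /= mulrDr [in g ^+ k * (g * _)]mulrA -exprSr.
  congr (_ + _); case: (head _ _); rewrite ?mulr1 ?mul1r //.
  by rewrite !mulr0 raddf0 mulr0 mul0r.
rewrite stepE addnS -addSn.
case: a ab => [|[] a] /= => [_|[-> ab]|[-> ab]].
- rewrite ZtoCD -addrA lerD ?IHl //.
  case: (head _ _); rewrite ?mul1r ?mul0r.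
    exact: le_trans (ZtoC_le (Z.le_min_r _ _)) le_lo.
  exact: (@ZtoC_le _ 0%BZ (Z.le_min_l _ _)).
- by rewrite mul1r ZtoCD -addrA lerD ?IHl.
- by rewrite mul0r add0r IHl.
Qed.
End Enclosure.

(** The digits of b themselves choose a path down the tree. At the leaf reached, the real part for
    the chosen root and direction is 0 because [bits g b = 0], while the test of the leaf makes its
    lower bound positive. *)
Lemma tree_okP p (p_ge0 : (0 <= p)%BZ) (zs : seq gauss) (b : seq bool) :
  (forall i, (i < size zs)%N -> let z := nth (G 0 0) zs i in
     (modulus_bound z < scale p)%BZ /\
     exists2 g, `|ZtoC (scale p) * g - gval z| <= ZtoC radius & bits g b = 0) ->
  forall t a, tree_ok (map (root_data p) zs) t a -> ~ agree (rev a) b.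
Proof.
move=> rootP; elim=> [i u v|t0 IH0 t1 IH1] a /=; last first.
  case/andP=> ok0 ok1 ab.
  case E: (nth false b (size (rev a))).
    by apply: IH1 ok1 _; rewrite rev_cons; apply: agree_rcons.
  by apply: IH0 ok0 _; rewrite rev_cons; apply: agree_rcons.
have [lt_i|ge_i] := ltnP i (size zs); last first.
  by rewrite nth_default ?size_map // Z.mul_0_r.
have [small [g near b0]] := rootP i lt_i.
rewrite (nth_map (G 0 0)) //; set z := nth _ _ _ in small near *.
have := root_dataP p_ge0 near small; case: (root_data p z) => l T [encl le_T].
move=> /Z.ltb_lt/ZtoC_lt; rewrite ZtoCM => lt_low ab.
have := lower_sumP p_ge0 near small u v encl ab.
rewrite b0 !mulr0 raddf0 mulr0 add0n subr_le0 => le_low.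
have W0 : 0 <= ZtoC (Z.abs u + Z.abs v) by apply: ZtoC_ge0; lia.
by have := lt_le_trans lt_low (le_trans le_low (ler_wpM2l W0 le_T)); rewrite ltxx.
Qed.

Notation mapC N := (map_poly (intr : int -> algC) N).

Lemma newmanP (N : {poly int}) :
  reflect (N`_0 = 1 /\ forall i, N`_i = 0 \/ N`_i = 1) (newman N).
Proof.
apply: (iffP andP) => [[/eqP N0 /allP N01]|[N0 N01]]; split=> //.
- move=> i; have [lt_i|ge_i] := ltnP i (size N); last by left; rewrite nth_default.
  by have := N01 _ (mem_nth 0 lt_i); rewrite !inE => /orP[] /eqP; [left | right].
- exact/eqP.
by apply/(all_nthP 0) => i _; case: (N01 i) => ->.
Qed.

Lemma newman_bits N g : newman N ->
  (mapC N).[g] = bits g (map (fun c => c == 1) N) /\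
  head false (map (fun c => c == 1) N) = true.
Proof.
move=> /andP[/eqP N0 /allP N01]; split; last first.
  by move: N0; case: (polyseq N) => //= c s ->.
rewrite map_polyE horner_Poly; move: N01; case: N {N0} => s /= _.
elim: s => //= c s IHs N01.
have {}IHs : horner_rec [seq x%:~R | x <- s] g = bits g [seq c == 1 | c <- s].
  by apply: IHs => d ds; apply: N01; rewrite in_cons ds orbT.
rewrite IHs addrC mulrC; congr (_ + _).
by have := N01 c (mem_head _ _); rewrite !inE => /orP[] /eqP->.
Qed.

(** Phrased with common roots rather than divisibility: the certificates use only the vanishing of N
    at roots, and reversal acts on roots simply by inversion. *)
Definition excluded (s : seq Z) : Prop := forall N, newman N ->
  ~ (forall g, root (cpoly s) g -> root (mapC N) g).

Lemma no_newman_multipleP p s zs t : cpoly s != 0 ->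
  no_newman_multiple p s zs t -> excluded s.
Proof.
move=> s0 /and3P[/Z.leb_le p0 /(all_nthP (G 0 0)) zsP ok_t] N newN sN.
(* The evaluation point is arbitrary: only the first digit being 1 is extracted here. *)
have [_ N1] := newman_bits 0 newN.
apply: (tree_okP (zs := zs) (b := map (fun c => c == 1) N) p0 _ ok_t) => //.
move=> i lt_i z; have /andP[near /Z.ltb_lt small] := zsP i lt_i.
split=> //; have [g rg near_g] := near_rootP p0 near s0.
by exists g => //; rewrite -(proj1 (newman_bits g newN)); apply/rootP/sN.
Qed.

(** * Reversal of the coefficients *)

Lemma horner_rcons (F : fieldType) (s : seq F) c x :
  (Poly (rcons s c)).[x] = (Poly s).[x] + c * x ^+ size s.
Proof.
rewrite !horner_Poly; elim: s => [|d s IHs] /=; first by rewrite mul0r !add0r expr0 mulr1.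
by rewrite IHs exprSr; ring.
Qed.

(** The factor x on the left makes the exponent [size s] instead of the degree, so that the empty
    list is covered too. *)
Lemma horner_rev (F : fieldType) (s : seq F) x : x != 0 ->
  x * (Poly (rev s)).[x] = x ^+ size s * (Poly s).[x^-1].
Proof.
move=> x0; elim: s => [|c s IHs]; first by rewrite !horner_Poly /= !mulr0.
rewrite rev_cons horner_rcons mulrDr IHs size_rev [in RHS]horner_Poly /= -horner_Poly.
by rewrite exprS; field.
Qed.

Lemma newman_rev N : newman N -> newman (Poly (rev N)).
Proof.
move=> newN; have /newmanP[N0 N01] := newN.
have Nn0 : N != 0 by apply: contraTneq newN => ->; rewrite /newman coef0.
apply/newmanP; split=> [|i]; rewrite coef_Poly.
  rewrite nth_rev ?lt0n ?size_poly_eq0 // subn1 -[_`__]/(lead_coef N).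
  have := N01 (size N).-1; rewrite -[_`__]/(lead_coef N) => -[/eqP|//].
  by rewrite lead_coef_eq0 (negPf Nn0).
have [lt_i|ge_i] := ltnP i (size N); last by left; rewrite nth_default ?size_rev.
by rewrite nth_rev.
Qed.

Lemma root_cpoly_rev s g : ZtoC (last 0%BZ s) != 0 ->
  root (cpoly (rev s)) g -> g != 0 /\ root (cpoly s) g^-1.
Proof.
move=> s0 rg; have s_n : s != [::] by apply: contraNneq s0 => ->; rewrite /= ZtoC0.
have g0 : g != 0.
  apply: contraTneq rg => ->; rewrite /root /cpoly horner_coef0 coef_Poly map_rev.
  rewrite nth_rev ?size_map ?lt0n ?size_eq0 // subn1 (nth_map 0%BZ); first by rewrite nth_last.
  by rewrite prednK // lt0n size_eq0.
split=> //; move: rg; rewrite /cpoly map_rev.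
have := horner_rev (map ZtoC s) g0 => /(congr1 (fun y => y == 0)).
by rewrite !mulf_eq0 expf_eq0 (negPf g0) andbF !orFb /root => ->.
Qed.

(** If N vanishes at the roots of P, the reversed N is again Newman and vanishes at their inverses,
    among which are all roots of the reversed P. *)
Lemma excluded_rev s : ZtoC (last 0%BZ s) != 0 -> excluded (rev s) -> excluded s.
Proof.
move=> s0 ex_rs N newN sN; apply: (ex_rs _ (newman_rev newN)) => g rg.
have [g0 /sN] := root_cpoly_rev s0 rg.
have := horner_rev (map (intr : int -> algC) N) g0 => /(congr1 (fun y => y == 0)).
by rewrite map_Poly map_rev map_polyE !mulf_eq0 expf_eq0 (negPf g0) andbF !orFb /root => ->.
Qed.

(** * Positive roots and cyclotomic products *)

Lemma bits_ge0 g b : 0 <= g -> (head false b)%:R <= bits g b.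
Proof.
move=> g0; have b0 : forall c, 0 <= bits g c.
  by elim=> //= x c IHc; rewrite addr_ge0 ?mulr_ge0 ?ler0n.
by case: b => //= x b; rewrite lerDl mulr_ge0.
Qed.

(** The intermediate value theorem is applied in the real closed field [algR], and the root found is
    then embedded in [algC]. *)
Definition ZtoR (x : Z) : algR := (int_of_Z x)%:~R.

Lemma ZtoRM x y : ZtoR (x * y)%BZ = ZtoR x * ZtoR y.
Proof. by rewrite /ZtoR -rmorphM -rmorphM. Qed.
Lemma ZtoRD x y : ZtoR (x + y)%BZ = ZtoR x + ZtoR y.
Proof. by rewrite /ZtoR -rmorphD -rmorphD. Qed.
Lemma ZtoR_ge0 x : (0 <= x)%BZ -> 0 <= ZtoR x.
Proof. by rewrite /ZtoR ler0z; lia. Qed.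

Lemma real_valueP x y s : ZtoR y != 0 ->
  let: (pw, h) := real_value x y s in
  ZtoR pw = ZtoR y ^+ size s /\
  ZtoR y * ZtoR h = ZtoR y ^+ size s * (Poly (map ZtoR s)).[ZtoR x / ZtoR y].
Proof.
move=> y0; elim: s => [|c s]; first by rewrite horner_Poly /= !mulr0.
rewrite /=; case: (real_value x y s) => pw h [Epw Eh].
rewrite cons_poly_def hornerD hornerMX hornerC ZtoRM Epw exprS; split=> //.
rewrite ZtoRD !ZtoRM mulrDr mulrCA Epw [ZtoR y * (ZtoR x * _)]mulrCA Eh.
by field.
Qed.

(** The bound 1 is the one that propagates: Horner's rule starts from the leading 1, and v >= 1
    gives 2 v + c >= 1 for c = 1 or -1. *)
Lemma sign_word_at2 s : sign_word s -> last 0%BZ s = 1%BZ -> 0 <= (Poly (map ZtoR s)).[2].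
Proof.
move=> ss l1; apply: le_trans (_ : 1 <= _); first exact: ler01.
rewrite horner_Poly; elim: s ss l1 => // c [|d s] IHs /= /andP[c1 ss].
  by move=> /= ->; rewrite mul0r add0r.
move=> /(IHs ss) /= le1.
have le_c : -1 <= ZtoR c :> algR.
  by move: c1; rewrite !inE => /orP[]/eqP->; rewrite ?lerN1z // (le_trans (lerN10 _)).
by have := lerD (ler_wpM2r (ler0n _ 2) le1) le_c; rewrite mul1r -[2%:R]natr1 addrK.
Qed.

Lemma positive_rootP s : sign_word s -> positive_root s -> excluded s.
Proof.
move=> ss /andP[/Z.eqb_eq l1 /hasP[x x_in]].
have {x_in} /andP[/Z.leb_le x0 /Z.leb_le x20] : ((0 <=? x) && (x <=? 20))%BZ.
  by move: x x_in; apply/allP.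
rewrite /nonpos_at; have n20 : ZtoR 20 != 0 by rewrite /ZtoR intr_eq0.
have := real_valueP x s n20; case: (real_value _ _ _) => pw h [_ Eh] /Z.leb_le h0 N newN sN.
set P := Poly _ in Eh.
have g20 : 0 < ZtoR 20 by rewrite lt_neqAle eq_sym n20 ZtoR_ge0.
have P_le0 : P.[ZtoR x / ZtoR 20] <= 0.
  rewrite -(pmulr_rle0 _ (exprn_gt0 (size s) g20)) -Eh pmulr_rle0 //.
  by rewrite /ZtoR lerz0; lia.
have le2 : ZtoR x / ZtoR 20 <= 2.
  by rewrite ler_pdivrMr // -[2]/(ZtoR 2) -ZtoRM /ZtoR ler_int; lia.
have [r /andP[le_r _] rP] := poly_ivt le2 (introT andP (conj P_le0 (sign_word_at2 ss l1))).
have r0 : 0 <= algRval r.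
  by apply: (le_trans _ le_r : (0 : algR) <= r); rewrite divr_ge0 ?ZtoR_ge0.
have : root (mapC N) (algRval r).
  apply: sN; rewrite (_ : cpoly s = map_poly algRval P) ?fmorph_root //.
  rewrite /cpoly /P map_Poly -map_comp; congr Poly.
  by apply: eq_map => c /=; rewrite /ZtoC /ZtoR rmorph_int.
rewrite /root; have [-> N1] := newman_bits (algRval r) newN.
have := bits_ge0 (map (fun c => c == 1) N) r0; rewrite N1 => le1.
by move=> /eqP b0; move: le1; rewrite b0 ler10.
Qed.

(** Since ['Phi_n] is monic, division by it stays in Z[X]. The remainder vanishes at z but has
    smaller degree than the minimal polynomial of z over the rationals, which is ['Phi_n], so it is
    0. *)
Lemma minimal_cyclotomic_dvd (P : {poly int}) n (z : algC) :
  n.-primitive_root z -> root (mapC P) z -> exists Q, P = Q * 'Phi_n.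
Proof.
move=> prim_z rootP; have mon := Cyclotomic_monic n.
exists (Pdiv.Ring.rdivp P 'Phi_n); have DP := Pdiv.RingMonic.rdivp_eq mon P.
set Q := Pdiv.Ring.rdivp _ _ in DP *; set r := Pdiv.Ring.rmodp _ _ in DP.
suff r0 : r = 0 by rewrite {1}DP r0 addr0.
have PhiC : mapC 'Phi_n = minCpoly z.
  by rewrite (minCpoly_cyclotomic prim_z) (Cintr_Cyclotomic prim_z).
have root_r : root (mapC r) z.
  move: rootP; rewrite {1}DP rmorphD rmorphM /= PhiC /root hornerD hornerM.
  by have /rootP-> := root_minCpoly z; rewrite mulr0 add0r.
have [q [Dq _] dvq] := minCpolyP z.
apply/eqP; apply: contraT => r0.
pose rQ := map_poly (intr : int -> rat) r.
have rQC : map_poly ratr rQ = mapC r :> {poly algC}.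
  by rewrite -map_poly_comp; apply: eq_map_poly => c /=; rewrite ratr_int.
have rQ0 : rQ != 0 by rewrite map_poly_eq0_id0 ?intr_eq0 ?lead_coef_eq0.
have := dvq rQ; rewrite rQC root_r => /esym/(dvdp_leq rQ0).
have -> : size q = size 'Phi_n.
  rewrite -(size_map_poly (ratr : rat -> algC)) -Dq -PhiC.
  by rewrite size_map_poly_id0 // (monicP mon) oner_eq0.
have -> : size rQ = size r by rewrite size_map_poly_id0 // intr_eq0 lead_coef_eq0.
by rewrite leqNgt Pdiv.Ring.ltn_rmodp monic_neq0.
Qed.

(** Induction on the degree: any root is a primitive m-th root of unity for some m, so ['Phi_m]
    splits off, and the cofactor is monic with roots among those of P. *)
Lemma is_cyclotomic_product_of_roots (P : {poly int}) : P \is monic ->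
  (forall z : algC, root (mapC P) z -> exists2 n, (0 < n)%N & z ^+ n = 1) ->
  is_cyclotomic_product P.
Proof.
have [k] := ubnP (size P); elim: k P => // k IHk P ltk monP rootsP.
have sizeC : size (mapC P) = size P by rewrite size_map_poly_id0 // (monicP monP) oner_eq0.
have [size1|size1] := eqVneq (size P) 1%N.
  exists [::] => //; rewrite big_nil.
  have [c c0 Pc] : exists2 c, c != 0 & P = c%:P by apply/size_poly1P/eqP.
  by have := monicP monP; rewrite Pc lead_coefC => ->.
have [z rz] : exists z : algC, root (mapC P) z by apply/closed_rootP; rewrite sizeC.
have [n n0 zn] := rootsP z rz.
have [m prim_z _] := prim_order_exists n0 zn.
have [Q DP] := minimal_cyclotomic_dvd prim_z rz.
have m0 := prim_order_gt0 prim_z.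
have monQ : Q \is monic by rewrite -(monicMr Q (Cyclotomic_monic m)) -DP.
have ltQ : (size Q < k)%N.
  have := ltk; rewrite DP size_Mmonic ?monic_neq0 ?Cyclotomic_monic //.
  by rewrite size_Cyclotomic addnS /= ltnS; apply: leq_trans; rewrite -addn1 leq_add2l totient_gt0.
have [|s s1 DQ] := IHk Q ltQ monQ.
  by move=> y ry; apply: rootsP; rewrite DP rmorphM rootM ry.
by exists (m :: s); rewrite /= ?m0 // big_cons DP DQ mulrC.
Qed.

(** * Arithmetic of coefficient lists and cyclotomic certificates *)

Lemma cpoly_add s t : cpoly (add s t) = cpoly s + cpoly t.
Proof.
elim: s t => [|a s IHs] [|b t]; rewrite ?cpoly_nil ?add0r ?addr0 //.
by rewrite [add _ _]/= !cpoly_cons IHs ZtoCD polyCD mulrDl addrACA.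
Qed.

Lemma cpoly_scale c t : cpoly (map (Z.mul c) t) = (ZtoC c)%:P * cpoly t.
Proof.
elim: t => [|d t IHt]; first by rewrite cpoly_nil mulr0.
by rewrite /= !cpoly_cons IHt ZtoCM polyCM mulrDr mulrA.
Qed.

Lemma cpoly_conv s t : cpoly (conv s t) = cpoly s * cpoly t.
Proof.
elim: s => [|c s IHs]; first by rewrite cpoly_nil mul0r.
rewrite [conv _ _]/= cpoly_add cpoly_scale !cpoly_cons IHs ZtoC0 addr0.
by rewrite mulrDl addrC mulrAC.
Qed.

Lemma horner_xn_sub_1 n x : (0 < n)%N -> (cpoly (xn_sub_1 n)).[x] = x ^+ n - 1.
Proof.
case: n => // n _; rewrite /xn_sub_1 cpoly_cons /cpoly map_rcons hornerD hornerMX hornerC.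
rewrite horner_rcons size_map size_nseq mul1r (_ : (Poly _).[x] = 0) ?add0r ?exprSr //.
by rewrite horner_Poly; elim: n => //= n ->; rewrite mul0r add0r.
Qed.

Lemma mul_xn_sub_1_cons n ns s :
  mul_xn_sub_1 (n :: ns) s = conv (xn_sub_1 n) (mul_xn_sub_1 ns s).
Proof. by []. Qed.

(** A root of P annihilates the left-hand product, hence one of the factors x^n - 1 with n in b. *)
Lemma cyclotomic_quotientP s a b : cyclotomic_quotient s a b ->
  forall z : algC, root (cpoly s) z -> exists2 n, (0 < n)%N & z ^+ n = 1.
Proof.
case/andP=> /allP b1 /eqP E z /rootP sz.
have: (cpoly (mul_xn_sub_1 a s)).[z] = 0.
  by elim: (a) => // n a' IHa; rewrite mul_xn_sub_1_cons cpoly_conv hornerM IHa mulr0.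
rewrite E; elim: b b1 {E} => [|n b IHb] b1.
  by rewrite /cpoly horner_Poly /= mul0r add0r => /eqP; rewrite oner_eq0.
have n0 : (0 < n)%N by apply: b1; rewrite mem_head.
rewrite mul_xn_sub_1_cons cpoly_conv hornerM horner_xn_sub_1 // => /eqP; rewrite mulf_eq0 subr_eq0.
case/orP=> [/eqP|/eqP /IHb]; first by exists n.
by apply=> m mb; apply: b1; rewrite in_cons mb orbT.
Qed.

(** * Classification *)

Definition ipoly (s : seq Z) : {poly int} := Poly (map int_of_Z s).

Lemma mapC_ipoly s : mapC (ipoly s) = cpoly s.
Proof. by rewrite map_Poly -map_comp. Qed.

Lemma ipoly_conv s t : ipoly (conv s t) = ipoly s * ipoly t.
Proof.
apply: (@map_inj_poly _ _ (intr : int -> algC) intr_inj) => //.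
by rewrite rmorphM /= !mapC_ipoly cpoly_conv.
Qed.

Lemma last_map_int s : last 0%BZ s != 0%BZ -> last 1 (map int_of_Z s) != 0.
Proof.
case: s => [|c s] //= l0; rewrite last_map.
by apply: contraNneq l0 => E; apply/eqP; lia.
Qed.

Lemma polyseq_ipoly s : last 0%BZ s != 0%BZ -> ipoly s = map int_of_Z s :> seq int.
Proof. by move=> l0; rewrite /ipoly (PolyK (last_map_int l0)). Qed.

Lemma sign_word_last s : sign_word s -> s != [::] -> last 0%BZ s \in [:: 1; -1]%BZ.
Proof. by move=> /allP ss; case: s ss => //= c s ss _; apply: ss; rewrite mem_last. Qed.

Lemma sign_word_last_neq0 s : sign_word s -> s != [::] -> ZtoC (last 0%BZ s) != 0.
Proof.
move=> ss s_n; have := sign_word_last ss s_n.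
by rewrite !inE => /orP[]/eqP->; rewrite /ZtoC intr_eq0.
Qed.

Lemma cpoly_neq0 s : ZtoC (last 0%BZ s) != 0 -> cpoly s != 0.
Proof.
move=> l0; have l1 : last 1 (map ZtoC s) != 0.
  by case: s l0 => [|c s] /=; rewrite ?ZtoC0 ?eqxx // last_map.
rewrite -size_poly_eq0 /cpoly (PolyK l1) size_map size_eq0.
by apply: contraNneq l0 => ->; rewrite ZtoC0.
Qed.

Lemma sign_word_rev s : sign_word (rev s) = sign_word s.
Proof. exact: all_rev. Qed.

Lemma last_rev_head (s : seq Z) : last 0%BZ (rev s) = head 0%BZ s.
Proof. by case: s => //= c s; rewrite rev_cons last_rcons. Qed.

Definition cyclotomic_roots (s : seq Z) : Prop :=
  forall z, root (cpoly s) z -> exists2 n, (0 < n)%N & z ^+ n = 1.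

Definition classified (s : seq Z) : Prop :=
  [\/ excluded s, s \in exceptions | cyclotomic_roots s].

Lemma exceptionalP s : s \in exceptions ->
  exists q z, exceptional_ok (s, q, z).
Proof.
have ok : all exceptional_ok exceptional_data by vm_compute.
rewrite /exceptions; elim: exceptional_data ok => //= -[[s' q] z] l IHl /andP[ok_s ok_l].
by rewrite in_cons => /orP[/eqP->|/(IHl ok_l)//]; exists q, z.
Qed.

(** Each alternative is invariant: Newman polynomials can be reversed, exceptional words are
    palindromes, and the inverse of a root of unity is a root of unity. *)
Lemma classified_rev s : sign_word s -> s != [::] ->
  classified (rev s) -> classified s.
Proof.
move=> ss s_n; have l0 := sign_word_last_neq0 ss s_n.
case=> [ex|exc|cyc].
- by apply: Or31; apply: excluded_rev.
- have [q [z /and3P[_ /eqP + _]]] := exceptionalP exc.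
  by rewrite revK => Ds; apply: Or32; rewrite Ds.
- apply: Or33 => z rz.
  have h0 : ZtoC (last 0%BZ (rev s)) != 0.
    by apply: sign_word_last_neq0; rewrite ?sign_word_rev // -size_eq0 size_rev size_eq0.
  have [|z0 /cyc[n n0 zn]] := root_cpoly_rev h0 (_ : root _ z); first by rewrite revK.
  by exists n => //; apply: invr_inj; rewrite -exprVn zn invr1.
Qed.

Lemma cert_okP s c : sign_word s -> s != [::] -> cert_ok s c -> classified s.
Proof.
move=> ss s_n; have s0 := cpoly_neq0 (sign_word_last_neq0 ss s_n).
have rs0 : cpoly (rev s) != 0.
  by apply/cpoly_neq0/sign_word_last_neq0; rewrite ?sign_word_rev // -size_eq0 size_rev size_eq0.
have viarev : excluded (rev s) -> classified s.
  by move=> ex; apply: classified_rev => //; apply: Or31.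
case: c => [a b|||||] /=.
- by move=> ok; apply: Or33; apply: cyclotomic_quotientP ok.
- exact: Or32.
- by move=> p x y u v ok; apply: Or31; apply: no_newman_multipleP ok.
- by move=> p x y u v ok; apply: viarev; apply: no_newman_multipleP ok.
- by move=> p zs t ok; apply: Or31; apply: no_newman_multipleP ok.
- by move=> p zs t ok; apply: viarev; apply: no_newman_multipleP ok.
Qed.

Lemma certified_sound ss cs s : certified ss cs -> s \in ss ->
  skipped s \/ exists c, cert_ok s c.
Proof.
elim: ss cs => // t ss IHss cs /=; rewrite in_cons.
case: ifP => [skip|_].
  by move=> /IHss IH /orP[/eqP->|/IH//]; left.
case: cs => // c cs /andP[ok /IHss IH] /orP[/eqP->|/IH//].
by right; exists c.
Qed.

Lemma mem_sign_words w : sign_word w -> w \in sign_words (size w).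
Proof.
elim: w => //= c w IHw /andP[c1 /IHw w_in]; rewrite mem_cat.
by move: c1; rewrite !inE => /orP[]/eqP->; apply/orP; [left|right]; apply: map_f.
Qed.

Lemma mem_monic_words s : sign_word s -> last 0%BZ s = 1%BZ -> (size s <= 13)%N ->
  s \in monic_words.
Proof.
case/lastP: s => // w c; rewrite last_rcons size_rcons => ss -> le_w.
move: ss; rewrite /sign_word all_rcons => /andP[_ ww].
apply/flatten_mapP; exists (size w); first by rewrite mem_iota.
by apply: map_f; apply: mem_sign_words.
Qed.

(** A word left to its reversal has constant term 1, so the reversal is monic and in the
    enumeration. The comparison of codes is strict, hence cannot send the reversal back, and one
    reversal suffices. *)
Lemma all_classified cs : certified monic_words cs ->
  forall s, sign_word s -> last 0%BZ s = 1%BZ -> (size s <= 13)%N -> classified s.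
Proof.
move=> cert.
have main s : sign_word s -> last 0%BZ s = 1%BZ -> (size s <= 13)%N ->
    ~~ ((head 0%BZ s =? 1)%BZ && (code (rev s) <? code s)%BZ) -> classified s.
  move=> ss l1 le_s nsk; have s_n : s != [::] by apply: contra_eqN l1 => /eqP->.
  have [|[c]] := certified_sound cert (mem_monic_words ss l1 le_s); last exact: cert_okP.
  rewrite /skipped (negPf nsk) /= => /orP[pos|pos].
    by apply: Or31; apply: positive_rootP.
  by apply: classified_rev => //; apply: Or31; apply: positive_rootP; rewrite ?sign_word_rev.
move=> s ss l1 le_s; have s_n : s != [::] by apply: contra_eqN l1 => /eqP->.
case: (boolP ((head 0%BZ s =? 1)%BZ && (code (rev s) <? code s)%BZ)); last exact: main.
move=> /andP[/Z.eqb_eq h1 /Z.ltb_lt lt_code]; apply: classified_rev => //.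
apply: main; rewrite ?sign_word_rev ?size_rev ?last_rev_head ?revK //.
by apply/negP => /andP[_ /Z.ltb_lt]; lia.
Qed.

(** * The nine exceptional polynomials *)

Lemma cyclotomic_product_root P z : is_cyclotomic_product P ->
  root (mapC P) z -> exists2 n, (0 < n)%N & z ^+ n = 1.
Proof.
case=> s /allP s1 ->; rewrite rmorph_prod /=.
elim: s s1 => [|n s IHs] s1; first by rewrite big_nil (negPf (root1 _)).
rewrite big_cons rootM => /orP[rz|]; last by apply: IHs => m ms; apply: s1; rewrite in_cons ms orbT.
have n0 : (0 < n)%N by apply: s1; rewrite mem_head.
(* X^n - 1 is the product of the ['Phi_d] over the divisors d of n, and the factor d = n vanishes at
   z. *)
exists n => //; have := prod_Cyclotomic n0 => /(congr1 (fun p => (mapC p).[z])).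
rewrite (big_rem n) ?divisors_id // rmorphM hornerM.
rewrite (rootP rz) mul0r rmorphB /= map_polyXn rmorph1 !hornerE.
by move/esym/eqP; rewrite subr_eq0 => /eqP.
Qed.

Lemma exceptions_sound s : s \in exceptions ->
  [/\ ipoly s \is monic, littlewood (ipoly s), ((size (ipoly s)).-1 <= 12)%N,
      exists N, newman N /\ zdvdp (ipoly s) N & ~ is_cyclotomic_product (ipoly s)].
Proof.
move=> /exceptionalP[q [z]].
case/and5P=> ss _ /eqP l1 le_s /and4P[near /Z.ltb_lt small /eqP h1 /allP q01].
have Es : ipoly s = map int_of_Z s :> seq int by rewrite polyseq_ipoly ?l1.
have s_n : s != [::] by apply: contra_eqN l1 => /eqP->.
have lead1 : lead_coef (ipoly s) = 1.
  by rewrite lead_coefE nth_last Es; case: (s) l1 => //= c t l1; rewrite last_map l1.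
split.
- exact/eqP.
- rewrite /littlewood -lead_coef_eq0 lead1 Es all_map.
  by apply: sub_all ss => c; rewrite !inE => /orP[]/eqP->.
- by rewrite Es size_map; lia.
- exists (ipoly q * ipoly s); split; last by exists (ipoly q).
  rewrite -ipoly_conv; apply/newmanP; rewrite /ipoly coef_Poly.
  split; first by move: h1; case: (conv q s) => //= c t ->.
  move=> i; rewrite coef_Poly; have [lt_i|ge_i] := ltnP i (size (conv q s)); last first.
    by left; rewrite nth_default ?size_map.
  rewrite (nth_map 0%BZ) //; have := q01 _ (mem_nth 0%BZ lt_i).
  by rewrite !inE => /orP[]/eqP->; [left|right].
have p0 : (0 <= 20)%BZ by lia.
have [g rg near_g] := near_rootP p0 near (cpoly_neq0 (sign_word_last_neq0 ss s_n)).
move=> cyc; have [|n n0 gn] := cyclotomic_product_root cyc (_ : root _ g); first by rewrite mapC_ipoly.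
have := g_lt1 p0 near_g small.
rewrite -(@expr_lt1 _ n) // -normrX gn normr1 ltxx //.
Qed.

(** A word ending in 1 loses no entry when it is normalised to a polynomial, so it can be read off
    from the polynomial; distinctness is then a comparison of integer lists. *)
Lemma uniq_exceptions : uniq (map ipoly exceptions).
Proof.
rewrite map_inj_in_uniq; first by vm_compute.
move=> s t /exceptionalP[q [z /and4P[_ _ /eqP ls _]]] /exceptionalP[q' [z' /and4P[_ _ /eqP lt _]]] E.
apply: (inj_map (can_inj int_of_ZK)).
by rewrite -!polyseq_ipoly ?ls ?lt // E.
Qed.

(** In the order in which [monic_words] lists the words that are not skipped, by increasing degree.
    Coordinates of roots are in units of 2^(-p); the precision p ranges from 11 to 20. *)
Definition certificates : seq cert := [::
Cyc [::] [::]; Cyc [:: 1] [:: 2]; Cyc [:: 1] [:: 3]; Cyc [:: 2; 3] [:: 1; 6];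
Cyc [:: 1] [:: 4]; Dir 11 (-1113) 0 1 0; Cyc [:: 1] [:: 5];
Rec 12 1775 2154 1 0; Dir 12 (-2379) 0 1 0; Rec 12 2836 1303 1 0;
Cyc [:: 2; 5] [:: 1; 10]; Cyc [:: 1] [:: 6]; Rec 11 932 1007 1 0;
Rec 11 (-1143) 0 1 0; Rec 11 1280 615 1 0; Dir 11 (-1042) 0 1 0;
Cyc [:: 1; 4; 6] [:: 2; 2; 12]; Cyc [:: 2; 3; 3] [:: 1; 6; 6];
Cyc [:: 1] [:: 7]; Rec 11 976 978 1 0; Rec 12 (-2334) 0 1 0;
Rec 11 1233 580 1 0; Dir 13 (-3482) 4636 1 0; Dir 12 (-1952) 1956 1 0;
Dir 13 (-2290) 5311 1 0;
RecT 16 [:: G 15256 51941; G 43408 36850] (Node (Node (Node (Leaf 0 1 0) (Node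
  (Node (Node (Leaf 0 1 1) (Node (Leaf 0 1 0) (Node (Leaf 0 1 0) (Leaf 1 1 0))))
  (Leaf 0 1 0)) (Leaf 0 1 0))) (Node (Node (Node (Leaf 1 1 0) (Leaf 0 1 0))
  (Node (Node (Leaf 1 1 (-1)) (Leaf 0 1 0)) (Leaf 0 1 0))) (Node (Node (Leaf 1 1
  (-1)) (Node (Leaf 1 0 (-1)) (Node (Leaf 0 1 0) (Node (Leaf 0 0 (-1)) (Node
  (Leaf 0 0 (-1)) (Leaf 1 1 0)))))) (Node (Leaf 1 0 (-1)) (Node (Leaf 0 1 1)
  (Node (Leaf 0 1 0) (Node (Leaf 0 1 0) (Node (Node (Node (Leaf 0 1 1) (Leaf 1 0
  (-1))) (Leaf 0 1 0)) (Leaf 0 1 0))))))))) (Node (Leaf 0 1 0) (Leaf 1 1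
  (-1))));
Dir 11 (-1052) 0 1 0; Rec 11 1517 373 1 0; Dir 12 (-2465) 1160 1 0; Exc;
Dir 12 1741 2318 1 0; Rec 12 2981 1176 3 (-1); Cyc [:: 2; 7] [:: 1; 14];
Cyc [:: 1] [:: 8]; Rec 11 1015 973 1 0; Rec 12 (-2305) 0 1 0;
Rec 11 1215 556 1 0; Rec 12 (-1717) 2217 1 0; Rec 12 2635 1533 1 0;
Dir 12 0 3020 1 0; Rec 11 1394 179 1 0; Dir 12 (-1556) 2131 1 0;
Rec 11 (-1047) 0 1 0; Rec 11 1421 390 1 0; Dir 14 (-5007) 10798 2 (-1);
Dir 12 (-1330) 2436 1 0;
RecT 16 [:: G (-41032) 0; G 56310 19419] (Node (Leaf 0 1 0) (Node (Node (Leaf 0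
  1 0) (Node (Node (Leaf 0 1 0) (Leaf 1 1 (-1))) (Leaf 0 1 0))) (Leaf 0 1 0)));
Dir 11 (-1113) 0 1 0; Exc; Rec 11 1400 534 1 0; Dir 11 (-1028) 0 1 0;
Dir 11 (-1095) 0 1 0; Rec 12 1077 2609 1 0; Dir 12 1821 2082 1 0;
Rec 11 1316 614 1 0;
RecT 16 [:: G (-18104) 51435; G 48102 30370] (Node (Node (Leaf 0 1 0) (Node
  (Node (Node (Leaf 0 1 1) (Node (Leaf 1 1 0) (Leaf 0 0 1))) (Node (Leaf 0 1 0)
  (Node (Leaf 1 1 (-1)) (Node (Leaf 1 0 (-1)) (Node (Leaf 0 1 0) (Node (Leaf 1 0
  (-1)) (Leaf 0 1 1))))))) (Leaf 0 1 0))) (Node (Leaf 0 1 (-1)) (Leaf 1 1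
  (-1))));
Cyc [:: 1] [:: 9]; Rec 12 2092 1974 1 0; Rec 13 (-4642) 0 1 0;
Rec 11 1210 540 1 0; Rec 12 (-1677) 2261 1 0; Rec 12 2638 1457 1 0;
RecT 16 [:: G (-49767) 18126; G 49136 24342] (Node (Leaf 0 1 0) (Leaf 1 1 0));
Rec 11 1354 210 1 0;
DirT 16 [:: G (-48772) 0; G (-7692) 51989] (Node (Leaf 0 1 0) (Node (Leaf 1 1 0)
  (Node (Leaf 0 1 0) (Node (Node (Leaf 0 1 0) (Node (Leaf 1 0 (-1)) (Leaf 0 1
  0))) (Leaf 0 1 0)))));
Dir 14 (-2541) 11896 9 (-2); Rec 11 (-1049) 0 1 0; Rec 11 1379 385 1 0;
Rec 13 (-2462) 5238 1 0; Rec 12 3012 1089 1 0;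
RecT 16 [:: G (-41679) 0; G 53560 18539] (Node (Leaf 0 1 0) (Leaf 1 1 0));
Rec 12 1596 2474 1 0; Dir 12 (-1532) 2146 1 0; Rec 11 1365 503 1 0;
Dir 12 (-1910) 1985 1 0; Dir 13 (-4184) 3947 1 0; Dir 12 (-1731) 2032 1 0;
Rec 12 1086 2565 1 0; Rec 11 (-1099) 0 1 0; Cyc [:: 1; 6; 9] [:: 3; 3; 18];
Rec 11 1700 290 1 0; Dir 16 (-26023) 40262 2 (-1); Rec 12 1814 2139 1 0;
Dir 11 (-1118) 0 1 0; Rec 11 1307 576 1 0; Dir 13 (-5417) 839 1 (-1);
Dir 12 (-2411) 0 1 0; Dir 11 (-1061) 0 1 0; Dir 11 (-1030) 0 1 0;
Rec 11 1570 215 1 0; Dir 11 (-1119) 0 1 0; Dir 11 (-1071) 0 1 0;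
Rec 12 1505 2242 1 0; Rec 12 3240 831 1 (-1); Dir 12 (-2420) 1081 1 0; Exc;
Rec 12 1192 2435 1 0; Dir 11 955 993 1 0; Rec 11 1248 587 1 0;
Dir 12 1677 2261 1 0; Cyc [:: 2; 3; 3] [:: 1; 6; 9]; Rec 11 1544 337 1 0;
Dir 12 1231 2619 1 0; Rec 14 12442 4531 1 (-1); Cyc [:: 2; 9] [:: 1; 18];
Dir 12 2749 1430 1 0; Cyc [:: 1] [:: 10]; Rec 12 2121 2034 1 0;
Rec 12 (-2312) 0 1 0; Rec 11 1210 530 1 0; Rec 13 (-3445) 4538 1 0;
Rec 11 1327 705 1 0;
RecT 16 [:: G (-48928) 23079; G 48928 23079] (Node (Leaf 0 1 0) (Leaf 1 1 0));
Rec 11 1333 220 1 0;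
RecT 16 [:: G (-47582) 0; G (-8552) 50179] (Node (Leaf 0 1 0) (Leaf 1 1 (-1)));
RecT 16 [:: G 19304 47419; G 45517 27296] (Node (Node (Leaf 0 1 0) (Leaf 1 1 0))
  (Leaf 0 1 0));
Rec 11 (-1048) 0 1 0; Rec 11 1358 377 1 0; Rec 13 (-2380) 5294 1 0;
Rec 11 1477 520 1 0;
RecT 16 [:: G (-41255) 0; G 52161 17680] (Node (Leaf 0 1 0) (Leaf 1 1 0));
Rec 12 1574 2418 1 0; Dir 13 (-1251) 5850 9 (-2); Rec 11 1350 483 1 0;
Rec 12 (-1916) 1955 1 0; Rec 13 6024 2482 2 (-1); Rec 13 (-4966) 2408 1 0;
Dir 13 0 6243 1 0; Rec 12 1113 2555 1 0; Rec 11 (-1097) 0 1 0;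
Rec 11 1499 118 1 0;
DirT 16 [:: G (-49578) 0; G 6293 52044] (Node (Node (Leaf 1 1 0) (Leaf 0 1 0))
  (Leaf 1 1 (-1)));
Rec 11 1617 327 1 0;
RecT 16 [:: G (-55888) 12225; G 55888 12225] (Node (Node (Node (Node (Node (Leaf
  0 1 0) (Leaf 1 1 (-1))) (Leaf 0 1 0)) (Leaf 1 1 0)) (Leaf 0 1 0)) (Leaf 1 1
  0));
Rec 12 1775 2154 1 0; Rec 11 (-1116) 0 1 0; Rec 11 1305 553 1 0;
Dir 12 (-1550) 2154 1 0; Dir 12 (-1596) 2114 1 0; Dir 12 (-1522) 2262 1 0;
Dir 12 (-1871) 1898 1 0; Rec 11 (-1029) 0 1 0; Rec 11 1498 257 1 0;
Rec 12 (-1291) 2438 1 0; Dir 12 (-1747) 1960 1 0; Dir 12 (-1851) 2114 1 0;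
Rec 11 745 1113 1 0; Rec 12 (-2397) 0 1 0; Rec 11 1528 405 1 0;
Dir 12 (-1375) 2502 2 (-1); Dir 12 (-1177) 2452 1 0; Rec 12 1203 2418 1 0;
Rec 11 (-1069) 0 1 0; Exc; Rec 11 949 1008 1 0; Dir 12 (-2379) 0 1 0;
Rec 11 1252 570 1 0; Dir 11 (-1106) 0 1 0; Dir 11 (-1136) 0 1 0;
Rec 11 1429 61 1 0; Dir 16 (-40077) 0 1 0; Rec 11 (-1059) 0 1 0;
Rec 11 1476 337 1 0; Dir 12 (-2356) 0 1 0; Dir 16 (-40021) 0 1 0;
Dir 11 (-1043) 0 1 0; Rec 11 1492 497 1 0; Dir 11 (-1025) 0 1 0;
Dir 11 (-1038) 0 1 0; Dir 11 (-1088) 0 1 0; Dir 11 (-1116) 0 1 0;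
Rec 11 856 1021 1 0; Rec 12 2836 1303 1 0;
DirT 16 [:: G (-44516) 0; G (-39413) 31146] (Node (Leaf 0 1 0) (Node (Leaf 1 1
  (-1)) (Leaf 0 1 0)));
Cyc [:: 1; 4; 10] [:: 2; 2; 20]; Rec 12 1589 2471 1 0; Rec 11 758 1069 1 0;
Dir 11 996 976 1 0; Rec 11 1222 562 1 0; Dir 11 899 1027 1 0;
Rec 11 1405 159 1 0; Dir 12 1757 2378 1 0; Rec 11 1439 382 1 0;
Dir 12 1557 2206 1 0; Rec 11 1424 536 1 0;
DirT 16 [:: G 26480 43668; G (-54734) 0] (Node (Node (Leaf 0 1 0) (Node (Leaf 0
  1 0) (Node (Leaf 0 0 (-1)) (Leaf 1 1 0)))) (Leaf 0 1 0));
Dir 12 1100 2658 1 0; Rec 11 1332 629 1 0; Cyc [:: 2; 5; 5] [:: 1; 10; 10];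
Dir 11 1255 625 1 0; Cyc [:: 1] [:: 11]; Rec 12 2087 2087 1 0;
Rec 13 (-4634) 0 1 0; Rec 11 1212 524 1 0; Rec 12 (-1705) 2242 1 0;
Rec 11 1337 690 1 0;
RecT 16 [:: G 48974 22157; G (-51712) 18273] (Node (Node (Node (Leaf 1 1 0)
  (Leaf 0 1 (-1))) (Leaf 0 1 0)) (Leaf 0 1 0));
Rec 11 1320 222 1 0;
RecT 16 [:: G (-48415) 0; G (-7473) 49852] (Node (Leaf 0 1 0) (Leaf 1 1 (-1)));
RecT 16 [:: G 46246 26152; G 20349 49389] (Node (Node (Node (Leaf 1 1 0) (Leaf 0
  1 (-1))) (Leaf 0 1 0)) (Leaf 0 1 0));
Rec 11 (-1049) 0 1 0; Rec 11 1347 370 1 0; Rec 13 (-2444) 5341 2 (-1);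
Rec 11 1463 502 1 0; Rec 16 51402 16962 1 (-1);
DirT 16 [:: G (-43507) 28412; G 9415 56260] (Node (Leaf 0 1 0) (Node (Node (Leaf
  1 1 (-1)) (Leaf 0 0 (-1))) (Node (Leaf 0 1 1) (Node (Leaf 0 1 0) (Node (Node
  (Leaf 0 1 0) (Node (Node (Leaf 1 1 (-2)) (Leaf 0 0 (-1))) (Leaf 0 1 0))) (Leaf
  0 1 0))))));
Rec 12 1590 2387 1 0;
DirT 16 [:: G (-39678) 29997] (Node (Leaf 0 1 0) (Node (Leaf 0 1 (-1)) (Leaf 0 3
  1)));
Rec 11 1343 469 1 0; Rec 12 (-1900) 1966 1 0; Rec 13 5974 2361 1 0;
Rec 13 (-5002) 2378 1 0; Rec 13 (-56) 6154 1 0; Rec 12 1129 2569 1 0;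
Rec 11 (-1098) 0 1 0; Rec 11 1464 159 1 0;
DirT 16 [:: G 18355 48896; G (-49392) 26779] (Node (Node (Leaf 0 1 0) (Leaf 1 1
  0)) (Leaf 0 1 (-1)));
Rec 11 1573 332 1 0; Rec 14 13552 3073 1 (-1); Rec 12 1755 2139 1 0;
Rec 11 (-1117) 0 1 0; Rec 11 1307 538 1 0; Rec 12 (-1547) 2142 1 0;
Rec 14 11977 5450 2 (-1); Dir 12 (-490) 2896 5 (-1);
DirT 20 [:: G (-707925) 0; G (-287859) 884072] (Node (Leaf 0 1 0) (Node (Node
  (Leaf 0 1 0) (Node (Node (Leaf 1 1 0) (Node (Leaf 0 (-1) 0) (Node (Node (Leaf
  1 3 1) (Node (Node (Node (Leaf 0 1 0) (Node (Leaf 1 1 (-1)) (Node (Leaf 0 1 0)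
  (Leaf 1 3 (-1))))) (Leaf 0 1 0)) (Node (Node (Node (Leaf 0 (-1) 0) (Node (Node
  (Leaf 0 (-1) 0) (Node (Leaf 1 3 1) (Leaf 0 (-1) 0))) (Leaf 0 (-1) 0))) (Leaf 0
  (-1) 0)) (Node (Leaf 1 1 0) (Node (Leaf 1 1 0) (Node (Node (Node (Leaf 1 1 0)
  (Node (Node (Node (Leaf 0 (-1) 0) (Node (Leaf 1 1 0) (Leaf 0 (-1) 0))) (Leaf 0
  (-1) 0)) (Leaf 1 1 0))) (Leaf 1 1 0)) (Leaf 1 1 0))))))) (Leaf 0 (-1) 0))))
  (Leaf 1 1 (-1)))) (Leaf 0 1 0)));
Rec 14 5883 10402 1 0; Rec 11 (-1030) 0 1 0; Rec 11 1462 265 1 0;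
Rec 12 (-1309) 2433 1 0; Rec 11 1589 403 1 0; Rec 14 (-9763) 0 1 0;
Rec 11 747 1106 1 0; Rec 12 (-2405) 0 1 0; Rec 11 1489 391 1 0;
Rec 12 (-1736) 2017 1 0; Dir 14 (-473) 12491 9 (-1); Dir 12 (-224) 2969 8 (-1);
DirT 16 [:: G (-50826) 0; G 4942 52912] (Node (Node (Leaf 1 1 0) (Leaf 0 1 0))
  (Node (Leaf 1 1 0) (Node (Leaf 0 1 0) (Node (Node (Node (Leaf 1 1 (-1)) (Leaf
  0 1 0)) (Leaf 1 0 (-1))) (Leaf 0 1 0)))));
Rec 12 1217 2418 1 0; Rec 11 (-1070) 0 1 0;
RecT 16 [:: G (-27015) 40178] (Node (Leaf 0 1 0) (Node (Leaf 0 0 (-1)) (Node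
  (Node (Leaf 0 1 0) (Node (Leaf 0 0 (-1)) (Node (Node (Leaf 0 1 0) (Leaf 0 0
  (-1))) (Leaf 0 0 (-1))))) (Leaf 0 1 0))));
Rec 11 1795 169 1 0; Rec 11 938 1011 1 0; Rec 12 (-2387) 0 1 0;
Rec 11 1257 561 1 0; Dir 16 (-26598) 40008 3 (-2); Dir 13 (-3180) 4773 1 0;
Rec 14 (-11012) 4059 2 (-1); Rec 11 1400 114 1 0; Dir 12 (-1515) 2128 1 0;
Rec 11 (-1060) 0 1 0; Rec 11 1444 331 1 0; Rec 12 (-1068) 2587 1 0;
Rec 12 (-53) 3010 1 0; Dir 12 (-1603) 2210 1 0; Rec 12 1634 2228 1 0;
Dir 12 (-1861) 1906 1 0; Rec 11 1464 465 1 0; Dir 13 (-4119) 3921 1 0;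
Dir 14 (-8346) 8350 1 0; Rec 12 (-2425) 1090 1 0; Rec 12 1295 2586 1 0;
Rec 11 (-1118) 0 1 0; Dir 12 (-1823) 2109 1 0; Rec 11 1705 102 1 0;
Dir 12 (-1817) 2014 1 0; Rec 11 850 1018 1 0; Rec 11 (-1138) 0 1 0;
Rec 11 1434 596 1 0; Dir 12 (-1129) 2569 3 (-1); Dir 12 (-1023) 2679 3 (-1);
Rec 12 1597 2438 1 0; Rec 11 (-1039) 0 1 0; Dir 12 (-1192) 2457 1 0;
Rec 11 1743 219 1 0; Dir 13 (-2455) 5079 1 0; Rec 11 758 1064 1 0;
Rec 16 (-40304) 0 1 0; Rec 11 1672 193 1 0;
RecT 16 [:: G 28354 42096; G 57993 9551] (Node (Node (Leaf 0 1 0) (Leaf 1 1 0))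
  (Leaf 0 1 0));
Rec 13 (-5254) 2342 2 (-1); Rec 12 1313 2382 1 0; Rec 11 (-1084) 0 1 0; Exc;
Rec 11 987 986 1 0; Dir 11 (-1144) 0 1 0; Rec 11 1226 555 1 0;
Dir 12 (-2420) 0 1 0; Dir 12 (-2343) 0 1 0; Rec 11 1380 175 1 0;
Dir 11 (-1123) 0 1 0; Rec 11 (-1043) 0 1 0; Rec 11 1416 369 1 0;
Dir 11 (-1146) 0 1 0; Dir 11 (-1126) 0 1 0; Rec 12 1737 2331 1 0;
Dir 16 (-40330) 0 1 0; Rec 11 1416 504 1 0; Dir 13 (-5281) 890 1 (-1);
Rec 13 (-4959) 2595 1 0; Rec 12 1117 2688 1 0; Rec 11 (-1089) 0 1 0;
Rec 11 1714 196 1 0; Dir 14 (-9769) 0 1 0; Rec 11 890 1026 1 0;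
Rec 11 1350 607 1 0; Dir 11 (-1063) 0 1 0; Dir 11 (-1054) 0 1 0;
Dir 11 (-1032) 0 1 0; Dir 11 (-1026) 0 1 0; Rec 11 1605 61 1 0;
Dir 11 (-1041) 0 1 0; Dir 11 (-1034) 0 1 0; Rec 11 778 1095 1 0;
Rec 11 1676 298 1 0; Dir 11 (-1125) 0 1 0; Dir 11 (-1107) 0 1 0;
Dir 11 (-1073) 0 1 0; Dir 11 (-1063) 0 1 0; Rec 11 924 973 1 0;
Rec 11 1268 617 1 0; Dir 13 (-5374) 1876 2 (-1);
DirT 16 [:: G (-46645) 19638] (Node (Leaf 0 1 0) (Node (Node (Node (Leaf 0 1
  (-1)) (Node (Node (Leaf 0 1 0) (Leaf 0 1 2)) (Leaf 0 1 (-1)))) (Leaf 0 0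
  (-1))) (Leaf 0 1 0)));
RecT 16 [:: G 32848 39204; G 7665 51796] (Node (Node (Leaf 1 1 0) (Leaf 0 1
  (-1))) (Leaf 0 1 0));
Rec 11 1606 244 1 0; Rec 12 13 2930 1 0;
DirT 16 [:: G (-49914) 0; G (-44495) 33340; G 40054 45237] (Node (Node (Node
  (Leaf 0 1 0) (Leaf 1 2 (-1))) (Leaf 0 1 0)) (Node (Node (Node (Node (Node
  (Node (Leaf 0 1 0) (Leaf 2 2 (-1))) (Leaf 0 1 0)) (Leaf 1 1 (-1))) (Node (Leaf
  0 1 0) (Node (Node (Leaf 0 1 0) (Node (Node (Leaf 0 1 0) (Node (Node (Leaf 0 1
  0) (Node (Node (Node (Node (Leaf 0 1 0) (Leaf 1 3 2)) (Leaf 0 1 0)) (Node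
  (Node (Node (Leaf 1 1 0) (Node (Node (Leaf 2 1 0) (Leaf 0 1 0)) (Node (Node
  (Leaf 1 1 0) (Node (Leaf 2 1 0) (Node (Leaf 1 1 0) (Leaf 2 1 0)))) (Node (Leaf
  1 1 0) (Node (Node (Leaf 1 1 0) (Node (Node (Node (Leaf 1 1 0) (Leaf 2 1
  (-1))) (Leaf 1 0 (-1))) (Leaf 2 1 0))) (Leaf 1 1 0)))))) (Leaf 1 1 0)) (Node
  (Node (Node (Leaf 0 1 0) (Node (Leaf 1 0 1) (Leaf 0 1 0))) (Leaf 0 1 0)) (Leaf
  2 1 0)))) (Node (Leaf 0 1 0) (Node (Leaf 1 3 2) (Leaf 0 1 0))))) (Leaf 0 1
  0))) (Leaf 0 1 0))) (Leaf 0 1 0)))) (Leaf 1 1 (-5))) (Node (Leaf 0 1 0) (Node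
  (Leaf 1 1 (-1)) (Leaf 0 1 0)))));
Rec 12 1695 2162 1 0; Dir 13 (-5073) 2469 2 (-1); Dir 12 (-2424) 1049 1 0;
Dir 12 (-2440) 1161 1 0; Rec 20 372038 696716 3 (-2); Rec 11 856 990 1 0;
Rec 13 5293 3331 1 0; Dir 16 (-46842) 5089 1 (-2); Rec 12 1713 2376 1 0;
Rec 11 778 1050 1 0; Dir 12 2059 1961 1 0; Rec 11 1213 545 1 0;
Dir 11 950 983 1 0; Rec 11 1361 203 1 0; Dir 11 911 1054 1 0;
Rec 11 1389 383 1 0; Dir 11 868 1008 1 0; Dir 13 3325 5001 2 (-1);
Rec 11 1376 507 1 0; Dir 12 1705 2242 1 0; Rec 12 1068 2587 1 0;
Rec 11 1709 263 1 0; Rec 11 1314 586 1 0;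
RecT 16 [:: G (-18355) 48896; G 49392 26779] (Node (Node (Leaf 0 1 0) (Node
  (Node (Leaf 0 0 1) (Leaf 1 1 (-1))) (Leaf 0 1 0))) (Leaf 1 1 (-1)));
Exc; Rec 11 1585 185 1 0; Dir 14 6754 10044 1 0; Rec 12 3298 775 2 (-1);
Dir 13 2444 5341 1 0; Dir 12 1192 2457 1 0; Rec 11 1251 595 1 0;
DirT 16 [:: G 43507 28412; G (-9415) 56260] (Node (Node (Node (Node (Leaf 0 1 0)
  (Leaf 1 1 0)) (Leaf 0 1 (-1))) (Leaf 0 1 0)) (Leaf 0 1 0));
Rec 11 1567 319 1 0; Rec 13 56 6154 1 0;
RecT 16 [:: G (-48974) 22157; G 51712 18273] (Node (Leaf 0 1 0) (Leaf 1 1 0));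
Cyc [:: 2; 11] [:: 1; 22]; Rec 13 5452 2989 1 0; Dir 11 1220 580 1 0;
Rec 11 1469 44 1 0; Rec 11 1510 397 1 0; Dir 12 2915 1227 1 0;
Cyc [:: 1] [:: 12]; Rec 12 2044 2083 1 0; Rec 12 (-2314) 0 1 0;
Rec 11 1214 521 1 0; Rec 13 (-3394) 4523 1 0; Rec 11 1348 681 1 0;
RecT 16 [:: G 49157 21476; G (-49157) 21476] (Node (Leaf 1 1 0) (Leaf 0 1 0));
Rec 11 1313 223 1 0;
RecT 16 [:: G (-47784) 0; G (-7121) 50695] (Node (Leaf 0 1 0) (Leaf 1 1 (-1)));
RecT 16 [:: G 46989 25371; G 17752 50364] (Node (Node (Leaf 1 2 1) (Leaf 0 1 0))
  (Leaf 0 1 0));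
Rec 11 (-1048) 0 1 0; Rec 11 1341 364 1 0; Rec 13 (-2450) 5283 2 (-1);
Rec 11 1456 488 1 0; Rec 13 6373 2048 2 (-1);
RecT 16 [:: G (-42746) 27574; G 7615 54560] (Node (Leaf 0 1 0) (Node (Leaf 1 1
  (-1)) (Node (Leaf 0 1 1) (Leaf 0 1 0))));
Rec 12 1613 2380 1 0;
RecT 16 [:: G (-42065) 0; G 53411 24350] (Node (Leaf 0 1 0) (Node (Node (Leaf 0
  1 0) (Node (Node (Leaf 0 1 0) (Leaf 1 1 (-1))) (Leaf 0 1 0))) (Leaf 0 1 0)));
Rec 11 1341 460 1 0; Rec 12 (-1913) 1969 1 0; Rec 12 2979 1137 1 0;
Rec 13 (-4972) 2387 1 0; Rec 13 0 6119 1 0; Rec 12 1124 2584 1 0;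
Rec 11 (-1097) 0 1 0; Rec 11 1443 174 1 0;
DirT 16 [:: G 26744 46323; G (-53489) 0] (Node (Node (Node (Leaf 0 1 0) (Node
  (Leaf 0 2 (-1)) (Node (Leaf 1 1 0) (Leaf 0 0 1)))) (Leaf 1 1 0)) (Leaf 0 1
  (-1)));
Rec 11 1548 330 1 0; Rec 13 6650 1515 1 0; Rec 12 1755 2124 1 0;
Rec 11 (-1116) 0 1 0; Rec 11 1310 529 1 0; Rec 12 (-1542) 2148 1 0;
Rec 14 12010 5199 2 (-1);
RecT 16 [:: G (-47215) 0; G 52765 19484] (Node (Leaf 0 1 0) (Leaf 1 1 0));
Dir 16 (-41879) 23742 5 (-3); Rec 14 6012 10465 2 (-1); Rec 11 (-1029) 0 1 0;
Rec 11 1442 266 1 0; Rec 12 (-1300) 2424 1 0; Rec 11 1562 393 1 0;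
Rec 13 (-4873) 0 1 0;
DirT 16 [:: G 14239 50784; G (-41467) 38559] (Node (Node (Leaf 0 1 0) (Node
  (Leaf 0 2 (-1)) (Node (Leaf 1 1 0) (Node (Node (Leaf 0 0 1) (Node (Leaf 0 1 1)
  (Node (Node (Leaf 1 1 0) (Leaf 0 2 1)) (Leaf 1 1 0)))) (Leaf 0 1 0))))) (Leaf
  0 1 (-1)));
Rec 11 751 1104 1 0; Rec 12 (-2400) 0 1 0; Rec 11 1468 379 1 0;
Rec 12 (-1740) 2025 1 0; Rec 13 6436 1845 1 0;
RecT 16 [:: G (-42809) 23232; G 55047 14689] (Node (Leaf 0 1 0) (Leaf 1 1 0));
RecT 16 [:: G (-49834) 0; G 4519 51771] (Node (Node (Leaf 1 1 0) (Leaf 0 1 0))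
  (Leaf 1 1 (-1)));
Rec 12 1222 2427 1 0; Rec 11 (-1069) 0 1 0; Rec 20 (-422760) 647816 2 (-1);
Rec 11 1637 84 1 0; Rec 11 1739 220 1 0; Rec 11 932 1007 1 0;
Rec 12 (-2382) 0 1 0; Rec 11 1263 555 1 0; Dir 13 (-700) 6013 8 (-1);
Rec 20 754028 377150 2 (-1); Rec 14 (-10983) 4184 2 (-1); Rec 11 1383 131 1 0;
Dir 14 (-2422) 11836 4 (-1); Dir 13 (-1342) 5852 4 (-1); Rec 11 (-1060) 0 1 0;
Rec 11 1427 325 1 0; Rec 12 (-1077) 2576 1 0; Rec 11 1562 447 1 0;
Dir 14 (-1767) 11971 3 (-1); Rec 12 1642 2216 1 0; Rec 13 (-5503) 801 1 (-1);
Rec 11 1450 444 1 0; Rec 13 (-4159) 3899 1 0; Rec 16 51785 16673 2 (-1);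
Rec 12 (-2418) 1095 1 0; Rec 20 (-58340) 800243 5 (-1); Rec 13 2614 5219 1 0;
Rec 11 (-1117) 0 1 0;
DirT 16 [:: G (-44669) 0; G (-11245) 49572] (Node (Leaf 0 1 0) (Leaf 1 1 (-1)));
Rec 11 1648 179 1 0; Rec 12 3508 523 1 (-1); Rec 11 849 1014 1 0;
Rec 11 (-1137) 0 1 0; Rec 11 1440 560 1 0; Rec 12 (-1516) 2249 1 0;
Dir 12 (-35) 3007 1 0; Dir 12 0 2921 1 0; Rec 12 1618 2428 4 (-1);
Rec 11 (-1039) 0 1 0; Rec 12 (-1190) 2446 1 0; Rec 11 1676 259 1 0;
Dir 12 (-122) 2979 1 0; Rec 11 760 1062 1 0; Rec 16 (-40126) 0 1 0;
Rec 11 1604 238 1 0; Rec 12 (-1832) 2126 1 0; Rec 14 13848 2618 1 (-1);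
Rec 13 (-5211) 2370 2 (-1); Cyc [:: 1; 8; 12] [:: 4; 4; 24];
Rec 12 1321 2387 1 0; Rec 11 (-1083) 0 1 0; Rec 16 (-22591) 43413 8 (-3);
Rec 11 979 985 1 0; Rec 11 (-1143) 0 1 0; Rec 11 1231 552 1 0;
Dir 12 (-1757) 2160 1 0; Rec 13 5544 3074 1 0; Dir 12 (-1693) 2175 1 0;
Rec 11 1366 181 1 0; Dir 14 (-6077) 10219 2 (-1); Rec 11 (-1043) 0 1 0;
Rec 11 1404 359 1 0;
RecT 16 [:: G (-19507) 46159; G (-56607) 0] (Node (Leaf 0 1 0) (Node (Leaf 0 0
  (-1)) (Node (Node (Node (Leaf 0 1 0) (Node (Leaf 0 0 (-1)) (Node (Node (Leaf 0
  1 0) (Leaf 1 1 0)) (Leaf 0 0 (-1))))) (Leaf 0 0 (-1))) (Leaf 0 1 0))));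
Rec 12 3088 982 1 0; Dir 14 (-6877) 9431 1 0; Rec 12 1749 2304 1 0;
Dir 12 (-1511) 2133 1 0; Rec 11 1413 483 1 0; Rec 12 (-1869) 1907 1 0;
Dir 12 (-1600) 2133 1 0; Dir 12 (-1553) 2105 1 0; Dir 12 (-1504) 2283 1 0;
Rec 11 (-1089) 0 1 0; Dir 12 (-1595) 2220 1 0; Rec 11 1650 238 1 0;
Dir 12 (-1548) 2197 1 0; Rec 11 887 1021 1 0; Rec 11 (-1107) 0 1 0;
Rec 11 1366 592 1 0; Dir 12 (-1890) 1890 1 0; Dir 12 (-1858) 1950 1 0;
Dir 13 (-4172) 3783 1 0; Rec 11 (-1025) 0 1 0; Rec 11 1547 152 1 0;
Rec 12 (-1383) 2476 2 (-1); Rec 11 1681 314 1 0; Rec 12 (-2401) 0 1 0;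
Rec 11 781 1092 1 0; Rec 12 (-2359) 0 1 0; Rec 11 1601 310 1 0;
Dir 11 (-870) 982 1 0; Dir 12 (-1764) 1964 1 0; Dir 12 (-1715) 1987 1 0;
Rec 12 1274 2493 1 0; Rec 11 (-1063) 0 1 0; Dir 12 (-1826) 2022 1 0;
Rec 11 920 971 1 0; Rec 12 (-2340) 0 1 0; Rec 11 1280 615 1 0;
Dir 14 (-4624) 10997 3 (-1); Dir 16 (-22482) 42989 2 (-1);
Dir 12 (-1057) 2546 1 0; Rec 11 (-1054) 0 1 0; Rec 11 1544 259 1 0;
Dir 12 (-1041) 2669 1 0; Rec 12 28 2938 1 0; Dir 13 (-2264) 5333 1 0;
Rec 12 1696 2149 1 0; Dir 12 (-1304) 2376 1 0; Rec 12 3226 820 1 0;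
Dir 12 (-1331) 2499 2 (-1); Rec 12 (-2430) 1164 1 0; Dir 12 (-1163) 2438 1 0;
Rec 11 (-1106) 0 1 0; Dir 12 (-1224) 2522 3 (-1); Rec 11 854 987 1 0;
Rec 11 (-1125) 0 1 0; Rec 13 5230 3460 1 0; Rec 20 565280 576850 6 (-1);
DirT 16 [:: G (-33302) 40446; G (-6839) 52102] (Node (Leaf 0 1 0) (Node (Leaf 0
  1 (-1)) (Node (Leaf 1 0 (-1)) (Leaf 0 1 0))));
Rec 12 1723 2355 1 0; Rec 11 (-1034) 0 1 0; Rec 11 779 1047 1 0;
Rec 13 (-4872) 0 1 0; Rec 12 2039 1968 1 0; Dir 12 (-2333) 0 1 0;
Rec 11 1216 542 1 0; Dir 11 (-1139) 0 1 0; Dir 12 (-2301) 0 1 0;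
Rec 11 1350 205 1 0; Dir 12 (-2367) 0 1 0; Rec 11 (-1051) 0 1 0;
Rec 11 1380 374 1 0; Rec 11 1514 517 1 0; Dir 12 (-2363) 0 1 0;
Dir 11 (-1113) 0 1 0; Dir 11 (-1122) 0 1 0; Rec 11 1377 492 1 0;
Dir 11 (-1104) 0 1 0; Dir 11 (-1112) 0 1 0; Dir 11 (-1133) 0 1 0;
Rec 11 (-1103) 0 1 0; Rec 11 1643 283 1 0; Dir 11 (-1131) 0 1 0;
Rec 12 1815 2094 1 0; Rec 11 1324 576 1 0; Dir 13 (-4966) 0 1 0;
RecT 16 [:: G (-52752) 0; G (-37091) 38117; G 56489 20918] (Node (Leaf 1 1 0)
  (Node (Node (Node (Leaf 1 1 (-1)) (Node (Leaf 1 0 (-1)) (Node (Node (Leaf 1 0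
  (-1)) (Node (Node (Leaf 2 1 (-1)) (Leaf 1 0 (-1))) (Leaf 1 1 (-1)))) (Leaf 1 0
  (-1))))) (Leaf 1 0 (-1))) (Node (Node (Node (Leaf 0 1 0) (Leaf 1 1 0)) (Leaf 0
  1 0)) (Leaf 2 1 (-1)))));
Dir 14 (-11545) 1388 2 (-3); Rec 11 (-1032) 0 1 0; Rec 11 1530 213 1 0;
Rec 12 3347 725 2 (-1); Rec 14 (-9848) 0 1 0; Rec 12 1536 2239 1 0;
Dir 13 (-4862) 0 1 0; Rec 11 1579 367 1 0; Dir 12 (-2347) 0 1 0;
Dir 12 (-2381) 0 1 0; Rec 12 1194 2468 1 0; Rec 11 (-1073) 0 1 0;
Rec 11 944 981 1 0; Rec 11 1259 592 1 0; Dir 11 (-1042) 0 1 0;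
Dir 11 (-1046) 0 1 0; Dir 11 (-1058) 0 1 0; Dir 11 (-1063) 0 1 0;
Rec 11 1518 309 1 0; Dir 11 (-1052) 0 1 0; Dir 11 (-1057) 0 1 0;
Dir 11 (-1028) 0 1 0; Dir 11 (-1031) 0 1 0; Dir 11 (-1024) 0 1 0;
Dir 11 (-1027) 0 1 0; Dir 11 (-1037) 0 1 0; Rec 11 (-1124) 0 1 0;
Rec 11 866 1004 1 0; Dir 11 (-1100) 0 1 0; Dir 11 (-1086) 0 1 0;
Dir 11 (-1093) 0 1 0; Dir 11 (-1113) 0 1 0; Rec 11 776 1068 1 0;
Rec 11 978 955 1 0; Rec 11 1226 578 1 0; Rec 13 5257 3360 1 0;
Cyc [:: 1; 4; 6; 6] [:: 2; 2; 12; 12]; Rec 11 1433 109 1 0;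
Dir 14 (-10905) 4546 2 (-1); Rec 11 1483 370 1 0; Rec 13 483 5918 1 0;
Dir 20 (-724138) 269614 2 (-1); Rec 12 1872 2270 1 0; Rec 12 2979 1137 1 0;
DirT 16 [:: G (-43891) 0; G (-40302) 29930] (Node (Leaf 0 1 0) (Node (Leaf 1 1
  (-2)) (Leaf 0 1 0)));
Rec 13 (-5032) 2474 1 0; Rec 12 1005 2686 1 0; Rec 11 904 1003 1 0;
Rec 11 1330 682 1 0; Dir 12 (-2421) 1296 4 (-1); Dir 12 (-2402) 1116 1 0;
Rec 12 1610 2199 1 0; Rec 11 926 952 1 0; Rec 11 1249 652 1 0;
Rec 13 4923 3825 2 (-1); Rec 14 8471 9065 3 (-1); Rec 12 1750 2131 1 0;
Rec 11 866 977 1 0; Dir 12 2105 2002 1 0; Rec 11 1210 533 1 0;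
Rec 11 1327 714 1 0; Rec 11 1337 217 1 0; Dir 11 953 1001 1 0;
Rec 11 1363 378 1 0; Rec 11 1487 523 1 0; Rec 12 1579 2452 4 (-1);
Rec 11 1356 487 1 0; Dir 11 905 1023 1 0; Dir 11 861 1019 1 0;
Rec 11 1507 97 1 0; Rec 11 1627 316 1 0; Rec 11 1308 559 1 0;
Dir 13 3622 4790 1 0; Dir 12 1658 2260 1 0; Rec 11 1508 248 1 0;
Dir 12 1727 2176 1 0; Dir 12 1495 2236 1 0; Rec 11 1545 399 1 0;
Dir 12 1568 2215 1 0; Dir 11 762 1072 1 0; Rec 11 1252 576 1 0;
RecT 16 [:: G (-9219) 51081; G 44974 26700] (Node (Node (Leaf 0 1 0) (Leaf 1 1
  0)) (Leaf 1 1 0));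
Cyc [:: 2; 3; 3] [:: 1; 6; 12]; Rec 11 1488 333 1 0; Rec 13 (-208) 6152 6 (-1);
Rec 11 1512 502 1 0;
DirT 16 [:: G 26744 46323; G (-53489) 0] (Node (Node (Node (Leaf 0 1 0) (Node
  (Leaf 0 2 (-1)) (Node (Leaf 1 1 0) (Leaf 0 0 1)))) (Leaf 1 1 0)) (Leaf 0 1
  (-1)));
Rec 12 1236 2598 1 0; Rec 12 2840 1364 4 (-1); Dir 12 1074 2647 1 0;
Rec 11 1222 566 1 0; Dir 12 2647 1596 6 (-1); Rec 11 1413 149 1 0;
Rec 11 1450 382 1 0; Rec 14 694 12190 1 0; Rec 11 1436 547 1 0;
DirT 20 [:: G (-262939) 849622; G 716842 562906; G (-990863) 0] (Node (Node
  (Node (Node (Node (Leaf 0 1 0) (Node (Node (Node (Leaf 0 1 0) (Leaf 1 1 0))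
  (Leaf 0 1 0)) (Leaf 0 1 1))) (Leaf 0 1 0)) (Leaf 0 1 0)) (Node (Node (Node
  (Leaf 1 1 0) (Node (Leaf 1 1 0) (Leaf 0 1 2))) (Node (Node (Leaf 1 1 0) (Leaf
  0 1 0)) (Node (Node (Leaf 1 0 (-1)) (Node (Leaf 1 0 (-1)) (Node (Leaf 0 0
  (-1)) (Leaf 1 1 0)))) (Node (Node (Leaf 1 0 (-1)) (Node (Node (Node (Node
  (Node (Node (Node (Leaf 1 1 (-1)) (Node (Leaf 1 0 (-1)) (Node (Leaf 0 0 1)
  (Node (Leaf 0 0 1) (Leaf 2 1 0))))) (Node (Leaf 2 1 0) (Node (Leaf 1 0 (-1))
  (Leaf 2 1 0)))) (Leaf 1 0 (-1))) (Leaf 1 0 (-1))) (Leaf 1 0 (-1))) (Leaf 1 1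
  (-1))) (Node (Node (Leaf 0 0 1) (Leaf 1 0 (-1))) (Leaf 1 1 0)))) (Node (Leaf 0
  1 0) (Node (Node (Node (Node (Leaf 0 1 0) (Node (Node (Node (Leaf 0 1 0) (Node
  (Leaf 0 3 (-2)) (Node (Node (Leaf 0 1 0) (Leaf 2 1 0)) (Leaf 0 1 0)))) (Leaf 0
  1 0)) (Leaf 0 1 0))) (Leaf 0 1 (-1))) (Leaf 0 1 0)) (Node (Node (Node (Leaf 0
  1 0) (Node (Node (Leaf 0 0 1) (Node (Leaf 0 1 0) (Node (Node (Node (Leaf 0 1
  1) (Node (Leaf 2 1 0) (Leaf 1 1 0))) (Leaf 0 3 2)) (Leaf 0 0 1)))) (Leaf 0 0
  1))) (Node (Node (Leaf 1 1 0) (Leaf 0 1 0)) (Node (Leaf 1 2 (-1)) (Node (Leaf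
  1 1 0) (Node (Leaf 0 1 0) (Node (Leaf 1 0 (-1)) (Leaf 0 1 1))))))) (Leaf 0 1
  0)))))))) (Leaf 0 2 1))) (Node (Leaf 0 1 (-1)) (Leaf 1 1 (-1))));
Rec 11 1329 642 1 0; Rec 11 1252 631 1 0; Dir 11 1209 554 1 0;
Rec 11 1390 190 1 0; Rec 11 1414 399 1 0; Rec 11 1385 539 1 0;
Cyc [:: 1] [:: 13]; Rec 12 2031 2062 1 0; Rec 13 (-4631) 0 1 0;
Rec 11 1217 520 1 0; Rec 13 (-3423) 4515 1 0; Rec 11 1358 678 1 0;
RecT 16 [:: G 49417 20977] (Node (Node (Node (Node (Node (Leaf 0 1 0) (Leaf 0 1
  (-1))) (Leaf 0 1 (-1))) (Leaf 0 1 0)) (Leaf 0 1 0)) (Leaf 0 1 0));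
Rec 11 1309 222 1 0;
RecT 16 [:: G (-48232) 0; G (-7993) 50860] (Node (Leaf 0 1 0) (Leaf 1 1 (-1)));
RecT 16 [:: G 17384 48946; G 47741 24846] (Node (Node (Leaf 0 1 0) (Leaf 1 1 0))
  (Leaf 0 1 (-1)));
Rec 11 (-1048) 0 1 0; Rec 11 1338 360 1 0; Rec 13 (-2414) 5295 2 (-1);
Rec 11 1453 478 1 0; Rec 13 6346 1990 2 (-1);
RecT 16 [:: G (-42820) 28372; G 8398 53545] (Node (Leaf 0 1 0) (Node (Leaf 1 1
  0) (Node (Leaf 0 1 1) (Leaf 0 2 (-1)))));
Rec 12 1629 2390 1 0;
RecT 16 [:: G (-42335) 0; G 53668 23215] (Node (Leaf 0 1 0) (Node (Node (Leaf 0
  1 0) (Leaf 1 1 (-1))) (Leaf 0 1 0)));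
Rec 11 1342 453 1 0; Rec 12 (-1908) 1961 1 0; Rec 12 2979 1106 1 0;
Rec 13 (-4993) 2391 1 0; Rec 13 32 6157 1 0; Rec 12 1113 2584 1 0;
Rec 11 (-1098) 0 1 0; Rec 11 1430 180 1 0;
RecT 16 [:: G (-39871) 39756; G (-18211) 55326; G 55648 17914] (Node (Node (Node
  (Node (Leaf 0 1 0) (Node (Leaf 1 2 (-1)) (Node (Leaf 0 1 1) (Leaf 2 0 (-1)))))
  (Leaf 0 1 0)) (Node (Node (Leaf 0 1 0) (Leaf 2 1 (-1))) (Leaf 0 1 0))) (Node
  (Node (Node (Node (Node (Node (Leaf 0 0 (-1)) (Leaf 1 1 (-1))) (Leaf 0 0
  (-1))) (Leaf 2 1 (-1))) (Leaf 2 1 (-1))) (Leaf 0 1 (-1))) (Leaf 2 1 0)));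
Rec 11 1532 326 1 0; Rec 12 3286 743 1 0;
DirT 16 [:: G (-53467) 0; G (-30659) 45274; G 22569 56287] (Node (Node (Node
  (Node (Leaf 1 1 0) (Leaf 0 1 0)) (Leaf 1 1 0)) (Leaf 0 1 0)) (Node (Node (Node
  (Node (Leaf 1 0 (-1)) (Node (Node (Leaf 1 1 0) (Node (Leaf 0 (-1) 0) (Node
  (Node (Leaf 1 1 (-1)) (Node (Leaf 1 0 (-1)) (Leaf 2 1 0))) (Leaf 1 1 0))))
  (Leaf 1 1 0))) (Leaf 1 0 (-1))) (Leaf 1 1 0)) (Node (Node (Node (Leaf 0 1 0)
  (Node (Node (Leaf 1 1 1) (Node (Node (Leaf 2 1 (-1)) (Node (Node (Node (Node
  (Leaf 1 2 1) (Node (Leaf 2 1 (-1)) (Leaf 1 1 3))) (Leaf 2 1 (-1))) (Leaf 1 1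
  1)) (Node (Node (Node (Leaf 0 1 0) (Node (Leaf 2 1 (-1)) (Leaf 0 1 0))) (Leaf
  0 1 0)) (Leaf 2 1 (-1))))) (Leaf 1 0 1))) (Leaf 0 1 0))) (Leaf 0 1 0)) (Node
  (Leaf 1 1 0) (Node (Leaf 0 1 0) (Node (Node (Leaf 1 1 0) (Node (Node (Node
  (Leaf 1 1 (-1)) (Node (Leaf 0 1 0) (Node (Node (Leaf 0 1 0) (Node (Leaf 1 0
  (-1)) (Leaf 0 1 0))) (Leaf 0 1 0)))) (Leaf 1 0 (-1))) (Node (Leaf 0 1 0) (Leaf
  1 2 (-1))))) (Leaf 1 1 0)))))));
Rec 12 1761 2117 1 0; Rec 11 (-1117) 0 1 0; Rec 11 1315 523 1 0;
Rec 12 (-1547) 2149 1 0; Rec 13 6032 2511 2 (-1);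
RecT 16 [:: G (-47766) 0; G 52582 18667] (Node (Leaf 0 1 0) (Leaf 1 1 0));
RecT 16 [:: G (-44181) 0; G (-18047) 51575] (Node (Leaf 0 1 0) (Node (Leaf 1 1
  (-1)) (Leaf 0 1 0)));
Rec 14 6024 10592 2 (-1); Rec 11 (-1030) 0 1 0; Rec 11 1431 265 1 0;
Rec 12 (-1297) 2432 1 0; Rec 11 1546 383 1 0; Rec 13 6641 1635 2 (-1);
RecT 16 [:: G 13607 50417; G (-39834) 36952] (Node (Node (Leaf 0 1 0) (Leaf 1 1
  1)) (Leaf 0 1 (-1)));
Rec 11 753 1106 1 0; Rec 12 (-2403) 0 1 0; Rec 11 1457 370 1 0;
Rec 12 (-1742) 2019 1 0; Rec 12 3181 891 1 0;
RecT 16 [:: G (-43033) 23910; G 54263 14199] (Node (Leaf 0 1 0) (Leaf 1 1 0));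
RecT 16 [:: G (-50565) 0; G 5168 51413] (Node (Node (Leaf 1 1 0) (Leaf 0 1 0))
  (Leaf 1 1 (-1)));
Rec 12 1218 2432 1 0; Rec 11 (-1070) 0 1 0;
RecT 16 [:: G (-26871) 40793; G 57497 14805] (Node (Leaf 0 1 0) (Node (Leaf 0 0
  (-1)) (Leaf 1 1 (-1))));
Rec 11 1606 133 1 0; Rec 11 1704 238 1 0; Rec 11 932 1002 1 0;
Rec 12 (-2385) 0 1 0; Rec 11 1267 553 1 0; Rec 16 (-26042) 40509 3 (-2);
RecT 16 [:: G (-8223) 52148; G 47907 22798] (Node (Node (Leaf 0 1 0) (Leaf 1 1
  0)) (Leaf 1 1 0));
Rec 14 (-11038) 4106 2 (-1); Rec 11 1373 138 1 0; Rec 13 (-1241) 5891 4 (-1);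
DirT 16 [:: G (-38922) 30733] (Node (Leaf 0 1 0) (Node (Leaf 0 0 (-1)) (Leaf 0 7
  3)));
Rec 11 (-1060) 0 1 0; Rec 11 1418 319 1 0; Rec 12 (-1068) 2574 1 0;
Rec 11 1548 432 1 0; Rec 16 53415 14210 1 (-1);
DirT 20 [:: G (-674786) 382710] (Node (Leaf 0 1 0) (Node (Leaf 0 3 (-2)) (Leaf 0
  1 0)));
Rec 12 1651 2215 1 0; Rec 13 (-5463) 804 1 (-1); Rec 11 1444 430 1 0;
Rec 12 (-2064) 1946 1 0; Rec 13 6404 1990 2 (-1); Rec 12 (-2424) 1094 1 0;
RecT 16 [:: G (-3971) 50561; G (-49047) 17586] (Node (Leaf 1 1 0) (Leaf 0 1
  (-1)));
Rec 13 2587 5252 1 0; Rec 11 (-1117) 0 1 0;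
RecT 16 [:: G (-16638) 46891] (Node (Leaf 0 1 0) (Leaf 0 1 (-1)));
Rec 11 1614 202 1 0; Rec 11 1716 273 1 0; Rec 11 851 1012 1 0;
Rec 11 (-1138) 0 1 0; Rec 11 1445 537 1 0; Rec 12 (-1522) 2253 1 0;
RecT 16 [:: G (-12515) 49778; G 35324 38657] (Node (Node (Leaf 0 1 0) (Leaf 1 1
  (-1))) (Leaf 1 1 0));
RecT 16 [:: G (-53609) 11926; G 55718 16460] (Node (Node (Node (Leaf 0 1 0)
  (Node (Node (Leaf 0 1 0) (Leaf 1 1 (-1))) (Leaf 0 1 0))) (Leaf 0 1 0)) (Leaf 1
  2 (-1)));
RecT 16 [:: G (-46702) 0; G (-14338) 47632] (Node (Leaf 0 1 0) (Leaf 1 1 (-1)));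
Rec 12 1634 2434 1 0; Rec 11 (-1039) 0 1 0; Rec 11 1524 86 1 0;
Rec 12 (-1185) 2450 1 0; Rec 11 1638 270 1 0; Rec 14 13909 2487 1 (-1);
DirT 16 [:: G 18214 50160; G (-48810) 28451] (Node (Node (Leaf 0 2 1) (Leaf 1 2
  1)) (Leaf 0 1 (-1)));
Rec 11 762 1062 1 0; Rec 16 (-40233) 0 1 0; Rec 11 1568 249 1 0;
Rec 12 (-1837) 2113 1 0; Rec 12 3372 661 1 0; Rec 13 (-5247) 2366 3 (-1);
DirT 16 [:: G (-41630) 32689; G 23085 51128] (Node (Leaf 0 1 0) (Node (Node
  (Leaf 1 1 0) (Leaf 0 0 (-1))) (Node (Leaf 1 1 (-1)) (Node (Leaf 0 1 0) (Node
  (Node (Leaf 0 1 0) (Leaf 1 0 (-1))) (Leaf 0 1 0))))));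
Rec 12 1321 2394 1 0; Rec 11 (-1083) 0 1 0;
RecT 16 [:: G (-22207) 43835; G 59680 11604] (Node (Leaf 0 1 0) (Node (Leaf 0 0
  (-1)) (Node (Node (Node (Leaf 0 1 0) (Leaf 1 1 (-1))) (Leaf 0 0 (-1))) (Leaf 0
  1 0))));
Rec 11 976 981 1 0; Rec 11 (-1143) 0 1 0; Rec 11 1234 551 1 0;
Rec 12 (-1764) 2151 1 0; Rec 14 11318 6180 2 (-1);
RecT 16 [:: G (-43424) 27405; G 52527 21806] (Node (Leaf 0 1 0) (Leaf 1 1
  (-1)));
Rec 11 1357 183 1 0; Dir 14 (-1468) 12076 4 (-1); Dir 13 (-792) 5950 4 (-1);
Rec 11 (-1043) 0 1 0; Rec 11 1397 352 1 0; Dir 14 (-1044) 12241 4 (-1);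
Rec 11 1535 472 1 0; Rec 16 (-40350) 0 1 0; Rec 12 1767 2296 1 0;
Dir 14 (-2714) 11640 3 (-1); Rec 11 1412 469 1 0; Rec 12 (-1866) 1903 1 0;
Rec 14 12757 4383 2 (-1); Rec 13 (-4942) 2601 1 0; Rec 12 (-54) 2966 1 0;
Rec 12 1080 2700 1 0; Rec 11 (-1089) 0 1 0; Dir 14 (-1853) 11988 4 (-1);
Rec 11 1615 249 1 0; Rec 13 6887 1221 1 (-1); Rec 11 888 1017 1 0;
Rec 11 (-1107) 0 1 0; Rec 11 1380 581 1 0; Rec 12 (-1592) 2109 1 0;
RecT 16 [:: G 39132 37948; G 52745 19852] (Node (Node (Node (Node (Leaf 0 1 0)
  (Node (Leaf 0 1 0) (Leaf 1 0 (-1)))) (Leaf 1 1 (-1))) (Leaf 1 1 (-1))) (Leaf 0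
  1 0));
RecT 16 [:: G (-44863) 0; G (-39076) 31469] (Node (Leaf 0 1 0) (Node (Leaf 1 1
  (-1)) (Leaf 0 1 0)));
DirT 16 [:: G (-43099) 0; G (-7927) 55404] (Node (Leaf 0 1 0) (Node (Leaf 1 2
  (-1)) (Leaf 0 1 0)));
RecT 16 [:: G 28783 41689] (Node (Node (Leaf 0 1 0) (Leaf 0 1 (-2))) (Leaf 0 1
  0));
Rec 11 (-1025) 0 1 0; Rec 11 1517 174 1 0; Rec 12 (-1383) 2490 2 (-1);
Rec 11 1641 315 1 0; Rec 12 (-2403) 0 1 0; Rec 11 784 1092 1 0;
Rec 12 (-2361) 0 1 0; Rec 11 1564 308 1 0; Rec 11 (-871) 980 1 0;
Rec 14 13565 2994 1 (-1); Rec 14 (-9971) 6271 2 (-1);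
RecT 16 [:: G (-47420) 0; G 1718 50766] (Node (Leaf 0 1 0) (Leaf 1 1 (-1)));
Rec 12 1267 2503 1 0; Rec 11 (-1063) 0 1 0;
DirT 16 [:: G (-46029) 0; G (-13749) 52979] (Node (Leaf 0 1 0) (Node (Leaf 1 1
  (-1)) (Leaf 0 1 0)));
Rec 11 919 968 1 0; Rec 12 (-2342) 0 1 0; Rec 11 1289 617 1 0;
Dir 13 161 6001 1 0; Dir 13 104 6086 1 0; Dir 13 280 6049 1 0;
Dir 12 (-95) 2976 1 0; Rec 11 (-1054) 0 1 0; Rec 11 1514 261 1 0;
Rec 12 (-1030) 2661 1 0; Rec 12 22 2950 1 0; Dir 12 41 2967 1 0;
Rec 12 1702 2144 1 0;
RecT 16 [:: G (-45771) 0; G (-48926) 0; G 35097 44052] (Node (Leaf 0 1 0) (Node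
  (Node (Leaf 2 1 0) (Node (Leaf 2 1 0) (Node (Leaf 0 1 0) (Node (Node (Node
  (Node (Node (Leaf 1 (-1) 0) (Leaf 0 1 0)) (Leaf 1 (-1) 0)) (Leaf 0 1 0)) (Leaf
  2 1 (-1))) (Node (Leaf 0 1 0) (Leaf 2 1 0)))))) (Leaf 0 1 0)));
Rec 11 1573 389 1 0; Rec 12 (-1974) 1900 1 0;
RecT 16 [:: G 36687 40128; G 55132 13588] (Node (Node (Node (Leaf 0 2 1) (Leaf 1
  1 0)) (Leaf 1 1 0)) (Leaf 0 1 (-1)));
Rec 12 (-2437) 1165 1 0; Dir 13 (-422) 5986 1 0; Dir 13 (-502) 5941 1 0;
Rec 11 (-1106) 0 1 0; Dir 13 (-242) 5991 1 0; Rec 11 1802 75 1 0;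
Rec 11 855 986 1 0; Rec 11 (-1126) 0 1 0; Rec 13 5142 3482 1 0;
Rec 12 (-1604) 2220 1 0; Rec 16 35256 35595 1 0; Dir 20 91499 781810 8 1;
Rec 12 1738 2350 1 0; Rec 11 (-1034) 0 1 0; Rec 12 (-1215) 2529 3 (-1);
Rec 12 3660 287 1 0; Rec 11 781 1046 1 0; Rec 14 (-9759) 0 1 0;
Rec 12 (-1826) 2014 1 0; Rec 11 1790 130 1 0; Rec 14 (-10415) 5432 2 (-1);
DirT 20 [:: G (-833281) 0; G (-55133) 857766] (Node (Node (Leaf 1 1 0) (Leaf 0 1
  0)) (Node (Leaf 1 1 0) (Node (Leaf 1 0 (-1)) (Node (Node (Node (Leaf 1 1 0)
  (Leaf 0 1 0)) (Node (Leaf 1 0 (-1)) (Node (Leaf 1 0 (-1)) (Node (Node (Node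
  (Leaf 1 1 (-1)) (Node (Leaf 0 1 0) (Node (Node (Leaf 0 1 0) (Node (Leaf 1 1
  (-2)) (Node (Leaf 0 1 0) (Node (Node (Leaf 0 1 0) (Node (Node (Leaf 0 1 0)
  (Node (Node (Leaf 0 1 0) (Node (Leaf 1 0 (-1)) (Node (Leaf 0 1 0) (Node (Node
  (Leaf 0 1 0) (Leaf 1 (-1) 0)) (Leaf 0 1 0))))) (Leaf 0 1 0))) (Leaf 0 1 0)))
  (Leaf 0 1 0))))) (Leaf 0 1 0)))) (Leaf 1 0 (-1))) (Leaf 1 1 (-1)))))) (Leaf 1
  1 0)))));
Rec 12 1403 2425 1 0; Rec 11 (-1076) 0 1 0;
RecT 16 [:: G (-21600) 50583; G (-35601) 43157; G 62358 6971] (Node (Node (Leaf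
  0 1 0) (Node (Node (Leaf 1 1 0) (Node (Node (Node (Leaf 1 1 1) (Leaf 0 1
  (-1))) (Leaf 0 1 0)) (Leaf 1 1 1))) (Leaf 0 1 0))) (Node (Leaf 0 1 (-1)) (Node
  (Node (Node (Node (Node (Node (Node (Node (Node (Leaf 0 1 (-1)) (Leaf 1 1 0))
  (Leaf 0 0 (-1))) (Node (Leaf 1 1 (-1)) (Leaf 0 1 0))) (Leaf 1 2 1)) (Leaf 0 0
  (-1))) (Node (Leaf 1 1 0) (Leaf 0 1 (-1)))) (Node (Node (Leaf 1 1 1) (Node
  (Node (Leaf 0 0 (-1)) (Node (Node (Node (Leaf 1 0 1) (Leaf 2 1 (-1))) (Leaf 1
  1 1)) (Leaf 0 0 (-1)))) (Leaf 1 0 1))) (Node (Leaf 1 1 0) (Node (Node (Node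
  (Leaf 1 2 1) (Leaf 0 1 (-1))) (Leaf 2 1 (-1))) (Leaf 1 1 0))))) (Node (Leaf 0
  0 (-1)) (Node (Leaf 0 0 (-1)) (Node (Node (Node (Leaf 0 0 (-1)) (Leaf 2 1
  (-1))) (Leaf 2 1 (-1))) (Leaf 0 0 (-1)))))) (Node (Leaf 1 1 0) (Node (Leaf 0 1
  0) (Leaf 2 3 (-2)))))));
Rec 11 1013 981 1 0; Rec 12 (-2335) 0 1 0; Rec 11 1219 541 1 0;
Dir 12 (-1635) 2240 1 0; Rec 12 2710 1488 1 0; Dir 13 (-3291) 4581 1 0;
Rec 11 1343 206 1 0; Dir 12 (-1755) 2123 1 0; Rec 11 (-1051) 0 1 0;
Rec 11 1376 367 1 0; Dir 12 (-1701) 2171 1 0; Rec 11 1511 498 1 0;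
Dir 12 (-1736) 2203 1 0; Rec 14 7089 10008 3 (-1); Rec 14 (-11237) 845 1 (-2);
Rec 11 1379 481 1 0; Rec 12 (-1887) 2021 1 0; Dir 13 (-3257) 4780 1 0;
Rec 13 (-5025) 2257 1 0; Rec 12 1050 2594 1 0; Rec 11 (-1103) 0 1 0;
Rec 11 1495 72 1 0; Dir 14 (-6978) 9431 1 0; Rec 11 1608 285 1 0;
Rec 14 13770 2675 1 (-1); Rec 12 1818 2084 1 0; Rec 11 (-1123) 0 1 0;
Rec 11 1333 571 1 0; Dir 12 (-1515) 2134 1 0; Dir 12 (-1524) 2124 1 0;
Dir 12 (-1517) 2156 1 0; Dir 12 (-1596) 2095 1 0; Rec 11 (-1032) 0 1 0;
Rec 11 1502 221 1 0; Rec 12 (-1304) 2383 1 0; Rec 11 1634 353 1 0;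
Dir 12 (-1566) 2125 1 0; Rec 12 1544 2242 1 0; Dir 12 (-1510) 2290 1 0;
Rec 11 1547 352 1 0; Rec 12 (-1705) 2039 1 0; Dir 12 (-1506) 2211 1 0;
Dir 12 (-1481) 2245 1 0; Rec 12 1188 2472 1 0; Rec 11 (-1073) 0 1 0;
Dir 12 (-1554) 2198 1 0; Rec 11 1791 52 1 0; Rec 11 943 978 1 0;
Rec 12 (-2418) 0 1 0; Rec 11 1265 592 1 0; Dir 12 (-1864) 2005 1 0;
Dir 12 (-1932) 2002 1 0; Dir 12 (-1850) 1899 1 0; Rec 11 (-1063) 0 1 0;
Rec 11 1493 301 1 0; Rec 12 (-1123) 2556 1 0; Dir 12 (-1839) 1936 1 0;
Dir 12 (-1882) 1929 1 0; Rec 12 1721 2218 1 0; Dir 12 (-2074) 1892 8 (-1);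
Rec 11 1547 443 1 0; Dir 14 (-8426) 8244 1 0; Dir 13 (-4062) 4124 1 0;
Rec 12 (-2423) 1052 1 0; Dir 12 (-1951) 1905 1 0; Rec 11 (-1125) 0 1 0;
Dir 12 (-1983) 1963 1 0; Rec 11 1812 131 1 0; Rec 11 867 1002 1 0;
Rec 11 (-1145) 0 1 0; Dir 12 (-1760) 2008 1 0; Dir 12 (-1701) 2024 1 0;
Dir 12 (-1731) 2052 1 0; Dir 11 (-867) 975 1 0; Rec 11 (-1041) 0 1 0;
Dir 11 (-858) 991 1 0; Rec 11 1749 77 1 0; Dir 12 (-1739) 1987 1 0;
Rec 11 778 1068 1 0; Dir 13 (-3809) 4228 1 0; Dir 12 (-1764) 2148 1 0;
Rec 12 3610 369 1 0; Rec 13 (-5230) 2170 2 (-1); Rec 12 1317 2452 1 0;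
Rec 11 (-1088) 0 1 0; Dir 12 (-1788) 2054 1 0; Rec 11 975 952 1 0;
Rec 12 (-2302) 0 1 0; Rec 11 1230 579 1 0; Rec 13 5262 3443 2 (-1);
Dir 12 (-1220) 2566 1 0; Rec 11 1414 126 1 0; Dir 20 (-270671) 737248 3 (-1);
Rec 11 (-1046) 0 1 0; Rec 11 1467 354 1 0; Dir 16 (-22254) 43620 3 (-1);
Rec 13 502 5941 1 0; Dir 14 (-5041) 10803 2 (-1); Rec 12 1882 2247 1 0;
Dir 12 (-1050) 2544 1 0; Rec 11 1504 526 1 0; Dir 13 (-2226) 5168 1 0;
Dir 12 (-1096) 2532 1 0; Rec 12 997 2675 1 0; Rec 11 (-1094) 0 1 0;
Dir 13 (-2230) 5327 1 0; Dir 12 (-1085) 2616 1 0; Rec 11 904 1000 1 0;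
Rec 11 (-1112) 0 1 0; Rec 11 1344 698 1 0; Dir 12 (-1321) 2394 1 0;
Dir 12 (-1276) 2393 1 0; Dir 13 (-2859) 5020 2 (-1); Rec 11 (-1027) 0 1 0;
Dir 12 (-1374) 2416 1 0; Rec 11 1768 168 1 0; Rec 12 (-2423) 0 1 0;
Rec 12 1618 2198 1 0; Rec 12 (-2384) 0 1 0; Rec 11 1710 137 1 0;
Dir 12 (-1218) 2432 1 0; Dir 12 (-1184) 2412 1 0; Rec 12 1217 2566 1 0;
Rec 11 (-1066) 0 1 0; Dir 12 (-1253) 2475 1 0; Rec 11 925 950 1 0;
Rec 12 (-2365) 0 1 0; Rec 11 1254 658 1 0; Rec 13 4865 3842 1 0;
Rec 20 (-728069) 261454 5 (-3); Rec 13 4213 4479 5 (-1); Rec 11 (-1057) 0 1 0;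
Rec 11 1658 26 1 0; Rec 12 95 2976 1 0;
RecT 16 [:: G (-43799) 0; G 60731 8189] (Node (Leaf 0 1 0) (Node (Node (Leaf 0 1
  0) (Node (Node (Node (Node (Node (Node (Leaf 0 1 0) (Leaf 1 1 (-1))) (Leaf 0 1
  0)) (Leaf 1 1 (-1))) (Leaf 0 1 0)) (Leaf 1 1 (-1))) (Leaf 1 1 (-1)))) (Leaf 0
  1 0)));
Rec 12 1755 2123 1 0; Rec 14 (-11076) 1373 1 (-1); Rec 12 3511 500 1 (-1);
RecT 16 [:: G 38303 37312; G 7754 55652] (Node (Node (Node (Leaf 0 2 1) (Node
  (Leaf 0 1 0) (Leaf 1 1 0))) (Leaf 0 1 (-1))) (Leaf 0 1 0));
Rec 12 (-2451) 1115 1 0; Dir 16 (-12840) 47060 3 (-1); Rec 11 (-1112) 0 1 0;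
Exc; Rec 11 867 975 1 0; Rec 11 (-1132) 0 1 0; Rec 12 2484 1625 1 0;
Rec 13 4486 4234 1 0; Dir 14 (-6217) 10101 2 (-1); Rec 12 1834 2329 1 0;
Rec 11 (-1036) 0 1 0; Rec 11 798 1047 1 0; Rec 13 (-4961) 0 1 0;
Rec 12 2085 1995 1 0; Dir 12 (-2306) 0 1 0; Rec 11 1213 532 1 0;
Rec 12 2676 1431 1 0; Dir 13 (-4647) 0 1 0; Rec 11 1331 217 1 0;
Dir 11 (-1146) 0 1 0; Rec 11 (-1047) 0 1 0; Rec 11 1360 371 1 0;
Rec 11 1486 507 1 0; Dir 11 (-1147) 0 1 0; Rec 12 1590 2473 1 0;
Dir 12 (-2369) 0 1 0; Rec 11 1358 479 1 0; Rec 13 6115 2408 2 (-1);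
Rec 12 (-2460) 1220 3 (-1); Rec 12 1087 2553 1 0; Rec 11 (-1095) 0 1 0;
Rec 11 1482 126 1 0; Rec 11 1596 312 1 0; Dir 12 (-2351) 0 1 0;
Dir 11 (-1118) 0 1 0; Dir 11 (-1114) 0 1 0; Rec 11 1315 555 1 0;
Dir 11 (-1124) 0 1 0; Dir 11 (-1119) 0 1 0; Dir 11 (-1109) 0 1 0;
Rec 11 (-1029) 0 1 0; Rec 11 1485 248 1 0; Rec 11 1619 382 1 0;
Dir 11 (-1110) 0 1 0; Dir 11 (-1140) 0 1 0; Dir 11 (-1134) 0 1 0;
Rec 11 1522 380 1 0; Dir 11 (-1148) 0 1 0; Dir 11 (-1141) 0 1 0;
Dir 11 (-1127) 0 1 0; Rec 11 (-1068) 0 1 0; Rec 11 1796 113 1 0;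
Rec 11 951 996 1 0; Rec 11 1257 575 1 0; Dir 14 (-10984) 1102 1 (-2);
Rec 16 (-44004) 18035 2 (-1); Rec 11 1417 73 1 0;
DirT 16 [:: G (-40620) 0; G (-59154) 0] (Node (Leaf 0 1 0) (Node (Node (Leaf 0 1
  0) (Node (Node (Leaf 0 1 0) (Node (Node (Leaf 0 1 0) (Node (Node (Leaf 0 1 0)
  (Leaf 1 (-1) 0)) (Leaf 0 1 0))) (Leaf 0 1 0))) (Leaf 0 1 0))) (Leaf 0 1 0)));
Rec 11 (-1058) 0 1 0; Rec 11 1470 322 1 0; Rec 13 (-259) 6164 8 (-1);
RecT 16 [:: G (-43493) 0; G 56316 14338] (Node (Leaf 0 1 0) (Leaf 1 1 (-1)));
Rec 12 1671 2259 1 0; Dir 14 (-11349) 1426 1 (-1); Rec 11 1506 468 1 0;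
Dir 13 (-5234) 890 1 (-1); Rec 12 (-2408) 1116 1 0; Rec 12 1222 2605 1 0;
Rec 11 (-1114) 0 1 0; Rec 12 3636 342 1 0; Rec 11 863 1017 1 0;
Dir 12 (-2396) 0 1 0; Dir 14 (-9793) 0 1 0; Dir 12 (-2415) 0 1 0;
Dir 12 (-2368) 0 1 0; Rec 11 (-1037) 0 1 0; Rec 11 1752 150 1 0;
Dir 12 (-2370) 0 1 0; Rec 11 764 1073 1 0; Dir 13 (-4965) 0 1 0;
Rec 11 1691 95 1 0; Rec 16 58076 7402 1 (-1); Rec 13 (-5147) 2468 2 (-1);
Rec 12 1291 2408 1 0; Rec 11 (-1081) 0 1 0; Rec 11 990 965 1 0;
Rec 11 1225 566 1 0; Dir 11 (-1052) 0 1 0; Dir 11 (-1050) 0 1 0;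
Rec 11 1397 157 1 0; Dir 11 (-1044) 0 1 0; Dir 11 (-1042) 0 1 0;
Rec 11 1440 368 1 0; Dir 11 (-1047) 0 1 0; Dir 11 (-1044) 0 1 0;
Dir 11 (-1061) 0 1 0; Rec 11 1448 525 1 0; Dir 11 (-1064) 0 1 0;
Dir 11 (-1061) 0 1 0; Dir 11 (-1055) 0 1 0; Rec 11 (-1087) 0 1 0;
Rec 11 1727 120 1 0; Dir 11 (-1055) 0 1 0; Rec 11 905 1019 1 0;
Rec 11 1345 647 1 0; Dir 11 (-1032) 0 1 0; Dir 11 (-1031) 0 1 0;
Dir 11 (-1026) 0 1 0; Dir 11 (-1024) 0 1 0; Dir 11 (-1028) 0 1 0;
Dir 11 (-1026) 0 1 0; Dir 11 (-1039) 0 1 0; Rec 11 1708 216 1 0;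
Dir 11 (-1042) 0 1 0; Dir 11 (-1040) 0 1 0; Dir 11 (-1035) 0 1 0;
Rec 11 (-1061) 0 1 0; Rec 11 932 962 1 0; Rec 11 1258 635 1 0;
Dir 11 (-1105) 0 1 0; Dir 11 (-1100) 0 1 0; Dir 11 (-1090) 0 1 0;
Rec 11 1647 164 1 0; Dir 11 (-1095) 0 1 0; Dir 11 (-1091) 0 1 0;
Dir 11 (-1120) 0 1 0; Dir 11 (-1116) 0 1 0; Dir 11 (-1127) 0 1 0;
Dir 11 (-1121) 0 1 0; Dir 11 (-1108) 0 1 0; Dir 11 (-1103) 0 1 0;
Rec 11 865 987 1 0; Dir 11 (-1069) 0 1 0; Dir 11 (-1074) 0 1 0;
Dir 11 (-1071) 0 1 0; Dir 11 (-1064) 0 1 0; Rec 11 787 1056 1 0;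
Rec 11 1024 956 1 0; Rec 11 1212 554 1 0; Rec 12 2619 1536 1 0;
DirT 16 [:: G (-48842) 18481; G 50362 26843] (Node (Leaf 0 1 0) (Node (Node
  (Node (Node (Leaf 1 1 0) (Leaf 0 0 (-1))) (Leaf 1 1 (-1))) (Leaf 1 1 (-1)))
  (Leaf 0 7 (-1))));
Rec 11 1378 191 1 0; Rec 14 3967 11387 9 (-2); Rec 11 1409 387 1 0;
Rec 14 12541 4446 1 (-1);
RecT 16 [:: G (-41781) 0; G 56111 17705] (Node (Leaf 0 1 0) (Node (Node (Leaf 0
  1 0) (Leaf 1 1 (-1))) (Leaf 0 1 0)));
Dir 14 (-11035) 3851 2 (-1); Rec 11 1395 528 1 0; Dir 13 (-5367) 1812 2 (-1);
Rec 12 (-2488) 1164 3 (-1); Rec 12 1036 2560 1 0; Rec 11 1732 197 1 0;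
RecT 16 [:: G (-49171) 11191; G 59248 8317] (Node (Leaf 0 1 0) (Leaf 1 1 (-1)));
Rec 11 935 1042 7 (-1); Rec 11 1312 610 1 0;
RecT 16 [:: G (-16316) 48320; G 45511 31484] (Node (Leaf 0 2 1) (Leaf 1 1
  (-1)));
DirT 20 [:: G (-779577) 0; G (-670680) 637669] (Node (Leaf 0 1 0) (Node (Node
  (Node (Node (Node (Node (Leaf 0 1 0) (Node (Node (Leaf 0 1 0) (Node (Node
  (Leaf 0 1 0) (Leaf 1 0 (-1))) (Leaf 0 1 0))) (Leaf 0 1 0))) (Leaf 0 1 0))
  (Node (Node (Node (Node (Leaf 1 1 0) (Node (Leaf 1 1 (-1)) (Node (Node (Leaf 1
  1 0) (Node (Leaf 0 1 0) (Leaf 1 1 0))) (Leaf 1 1 0)))) (Leaf 1 1 0)) (Node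
  (Node (Node (Leaf 0 (-1) 0) (Leaf 1 2 1)) (Leaf 0 (-1) 0)) (Node (Leaf 1 1 0)
  (Node (Leaf 0 (-1) 0) (Leaf 1 1 0))))) (Node (Leaf 0 1 0) (Node (Node (Node
  (Node (Leaf 0 1 0) (Leaf 1 0 (-1))) (Leaf 0 1 0)) (Node (Node (Node (Leaf 1 0
  (-1)) (Node (Leaf 0 1 0) (Node (Node (Leaf 1 0 (-1)) (Node (Node (Node (Leaf 1
  0 (-1)) (Node (Node (Leaf 1 1 (-1)) (Leaf 0 1 0)) (Leaf 1 0 (-1)))) (Leaf 1 1
  (-6))) (Leaf 1 0 (-1)))) (Leaf 1 0 (-1))))) (Leaf 1 0 (-1))) (Node (Leaf 0 1
  0) (Leaf 1 1 (-2))))) (Leaf 0 1 0))))) (Leaf 0 1 0)) (Node (Leaf 1 1 (-1))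
  (Node (Node (Node (Leaf 1 0 (-1)) (Node (Node (Node (Leaf 1 0 (-1)) (Node
  (Leaf 0 1 0) (Leaf 1 0 (-1)))) (Leaf 1 0 (-1))) (Leaf 1 1 (-2)))) (Leaf 0 1
  0)) (Node (Node (Leaf 1 1 (-1)) (Node (Leaf 0 (-1) 0) (Node (Leaf 1 1 0) (Leaf
  0 (-1) 0)))) (Leaf 1 1 (-2)))))) (Node (Leaf 0 1 0) (Node (Node (Leaf 0 1 0)
  (Leaf 1 4 (-1))) (Leaf 0 1 0)))));
Rec 16 20431 44299 4 (-1); Rec 11 1621 89 1 0; Rec 20 914202 147957 1 (-1);
Rec 14 (-9796) 0 1 0; Rec 12 1538 2283 1 0; Rec 12 3426 617 1 (-1);
Dir 20 (-746041) 189416 3 (-2);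
RecT 20 [:: G (-698146) 355200; G 263903 941969] (Node (Leaf 0 1 0) (Node (Node
  (Node (Leaf 0 0 (-1)) (Node (Node (Leaf 0 1 0) (Node (Node (Leaf 0 1 0) (Node
  (Node (Node (Leaf 0 0 (-1)) (Node (Node (Node (Leaf 0 (-1) 0) (Leaf 1 2 (-1)))
  (Leaf 0 (-1) 0)) (Leaf 0 0 (-1)))) (Leaf 0 0 (-1))) (Node (Node (Node (Leaf 0
  1 2) (Leaf 0 1 0)) (Leaf 0 0 1)) (Node (Leaf 0 0 (-1)) (Node (Leaf 1 1 0)
  (Leaf 0 1 (-1))))))) (Leaf 0 1 0))) (Leaf 0 0 (-1)))) (Leaf 0 0 (-1))) (Leaf 0
  1 0)));
Rec 12 1158 2460 1 0; Rec 11 957 968 1 0; Rec 11 1245 609 1 0;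
Rec 13 5183 3593 3 (-1); Dir 13 (-5015) 2630 2 (-1); Rec 11 1630 268 1 0;
Dir 13 (-5155) 2466 2 (-1); Dir 13 (-4958) 2529 1 0; Rec 12 1770 2263 1 0;
Dir 12 (-2424) 1108 1 0; Dir 12 (-2433) 1039 1 0; Dir 12 (-2414) 1076 1 0;
Rec 12 1142 2645 1 0; Rec 11 880 1004 1 0; Rec 12 2618 1517 1 0;
RecT 16 [:: G (-13677) 48275] (Node (Leaf 0 1 0) (Leaf 0 1 (-1)));
Dir 14 (-9937) 6498 5 (-2); Rec 11 782 1080 1 0; Rec 11 984 938 1 0;
Rec 11 1216 591 1 0; Rec 12 2532 1671 1 0; Rec 16 13856 46405 1 0;
Rec 11 1585 398 1 0; Rec 14 1167 12101 9 1; Exc; Rec 12 1985 2235 6 (-1);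
Rec 13 5749 2763 1 0; Dir 14 (-11443) 1436 1 (-2); Rec 12 997 2630 1 0;
Rec 11 920 997 1 0; Rec 11 1285 694 1 0; Dir 13 (-4952) 0 1 0;
Dir 12 (-2410) 0 1 0; Rec 12 1637 2238 1 0; Rec 11 935 943 1 0;
Rec 11 1226 658 1 0; Rec 13 4840 3669 1 0; Rec 13 4359 4355 1 0;
Rec 12 1797 2135 1 0; Rec 11 877 975 1 0; Dir 12 2107 2061 1 0;
Rec 11 1212 526 1 0; Rec 11 1335 696 1 0; Rec 11 1323 221 1 0;
Dir 11 992 981 1 0; Rec 11 1350 371 1 0; Rec 11 1468 505 1 0;
Dir 11 943 1010 1 0; Rec 11 1346 472 1 0; Dir 11 954 981 1 0;
Dir 11 928 972 1 0; Rec 11 1469 152 1 0; Rec 11 1581 328 1 0;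
Dir 12 1764 2148 1 0; Rec 11 1308 542 1 0; Dir 12 1837 2113 1 0;
Dir 11 894 1027 1 0; Rec 11 1469 262 1 0; Rec 11 1598 399 1 0;
Rec 11 745 1109 1 0; Rec 11 1498 390 1 0; Dir 11 871 1010 1 0;
Dir 11 858 991 1 0; Rec 11 1256 564 1 0; Dir 13 3255 5064 2 (-1);
Rec 11 1405 106 1 0; Dir 12 1744 2358 1 0; Rec 11 1451 330 1 0;
Dir 12 1927 2320 4 (-1); Dir 12 1635 2240 1 0; Rec 11 1474 469 1 0;
Dir 12 1712 2258 1 0; Rec 12 1275 2578 1 0; Rec 11 1710 69 1 0;
Rec 12 2880 1227 1 0; Dir 12 1522 2253 1 0; Dir 11 777 1099 1 0;
Rec 11 1748 200 1 0; Dir 11 757 1067 1 0; Rec 11 1681 169 1 0;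
Dir 11 773 1074 1 0; Dir 11 778 1052 1 0; Rec 11 1225 558 1 0;
Rec 13 5399 3128 1 0; Rec 11 1384 172 1 0; Exc; Rec 11 1422 370 1 0;
Rec 13 242 5991 1 0; Rec 11 1422 511 1 0;
RecT 16 [:: G (-33077) 43903; G 52873 20366] (Node (Node (Node (Node (Leaf 0 1
  0) (Node (Node (Node (Leaf 0 1 0) (Node (Leaf 0 1 (-1)) (Node (Leaf 1 1 (-1))
  (Leaf 0 1 0)))) (Leaf 0 1 0)) (Leaf 1 0 (-1)))) (Leaf 0 1 0)) (Leaf 1 1 (-1)))
  (Leaf 1 1 0));
Rec 12 1115 2664 1 0; Rec 11 1720 176 1 0; Rec 11 1347 617 1 0;
Dir 20 355313 701364 3 (-2);
DirT 16 [:: G 26587 43059; G (-57928) 0] (Node (Node (Leaf 0 1 0) (Node (Leaf 0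
  1 0) (Node (Leaf 0 0 (-1)) (Node (Leaf 0 0 (-1)) (Node (Node (Node (Node (Leaf
  0 1 0) (Node (Leaf 0 1 0) (Node (Leaf 1 1 0) (Node (Node (Leaf 1 1 0) (Node
  (Node (Leaf 0 1 0) (Node (Leaf 0 1 0) (Leaf 1 1 0))) (Leaf 1 1 0))) (Leaf 0 1
  0))))) (Leaf 0 1 (-2))) (Leaf 0 1 0)) (Leaf 0 1 0)))))) (Leaf 0 1 0));
Rec 14 14132 2185 1 (-1); Rec 11 1691 277 1 0; Dir 14 6718 10198 2 (-1);
Rec 12 1253 2475 1 0; Rec 11 1264 621 1 0; Dir 12 1068 2574 1 0;
Rec 11 1622 226 1 0; Rec 12 (-7) 2930 1 0; Dir 12 1220 2566 1 0;
Dir 12 1207 2647 1 0; Dir 16 22254 43620 3 (-2); Rec 12 2624 1637 8 (-1);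
Dir 12 1185 2450 1 0; Rec 11 1212 547 1 0; Dir 12 2636 1495 1 0;
Rec 11 1366 201 1 0; Rec 11 1393 385 1 0; Dir 12 2577 1649 6 (-1);
Rec 11 1380 513 1 0; Dir 16 42820 28372 2 (-1); Rec 11 1720 246 1 0;
Rec 11 1312 592 1 0;
DirT 16 [:: G (-18214) 50160; G 48810 28451] (Node (Node (Leaf 0 1 0) (Node
  (Node (Leaf 0 1 1) (Leaf 1 1 (-2))) (Leaf 0 1 0))) (Leaf 1 2 (-1)));
Rec 11 1598 165 1 0;
RecT 16 [:: G 56677 11073; G 13686 57212; G (-8476) 58456] (Node (Node (Node
  (Node (Node (Node (Node (Node (Node (Node (Leaf 2 4 (-1)) (Leaf 1 1 0)) (Leaf
  1 1 0)) (Leaf 0 1 (-1))) (Leaf 0 1 (-1))) (Leaf 0 1 (-1))) (Leaf 0 1 (-1)))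
  (Leaf 0 1 (-1))) (Leaf 0 1 0)) (Leaf 0 1 0)) (Leaf 0 1 0));
Rec 13 6701 1491 1 (-1);
RecT 16 [:: G 23581 48749; G (-24986) 48569] (Node (Node (Leaf 1 1 0) (Node
  (Node (Leaf 0 1 0) (Node (Node (Node (Node (Leaf 0 1 0) (Node (Leaf 0 1 0)
  (Leaf 1 1 0))) (Leaf 0 1 (-1))) (Leaf 0 1 0)) (Leaf 0 1 0))) (Leaf 1 1 0)))
  (Leaf 0 1 (-1)));
Rec 11 1248 598 1 0; Rec 11 1587 312 1 0; Rec 13 (-32) 6157 1 0;
RecT 16 [:: G (-49417) 20977; G 53935 19531] (Node (Leaf 0 1 0) (Leaf 1 1
  (-1)));
Cyc [:: 2; 13] [:: 1; 26]; Rec 13 5379 2989 1 0; Rec 11 1218 583 1 0;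
Rec 11 1526 402 1 0; Dir 13 422 5986 1 0; Rec 13 5810 2536 1 0;
Rec 11 1302 679 1 0; Rec 11 1235 650 1 0; Dir 11 1207 538 1 0;
Rec 11 1351 214 1 0; Rec 11 1374 388 1 0; Rec 11 1357 504 1 0;
Dir 11 1299 572 1 0; Rec 11 1568 229 1 0; Rec 12 3227 871 2 (-1);
Rec 11 1537 350 1 0; Dir 13 6105 2310 1 0; Rec 11 1451 115 1 0;
Dir 11 1476 409 1 0; Dir 11 1419 178 1 0].

Lemma certificates_ok : certified monic_words certificates.
Proof. by vm_cast_no_check (erefl true). Qed.

Theorem theorem2 :
  exists s : seq {poly int},
    [/\ uniq s,
        size s = 9%N &
        forall P : {poly int},
          P \in s <->
          [/\ P \is monic,
              littlewood P,
              ((size P).-1 <= 12)%N,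
              exists N : {poly int}, newman N /\ zdvdp P N &
              ~ is_cyclotomic_product P]].
Proof.
exists (map ipoly exceptions); split; [exact: uniq_exceptions | by [] |] => P.
split=> [/mapP[s s_exc ->]|[monP /andP[P0 lP] leP [N [newN [Q DN]]] ncyc]].
  exact: exceptions_sound.
pose s := map Z_of_int P.
have Ds : ipoly s = P.
  by rewrite /ipoly -map_comp map_id_in ?polyseqK // => c _; apply: Z_of_intK.
have ss : sign_word s.
  by rewrite /sign_word all_map; apply: sub_all lP => c; rewrite !inE => /orP[]/eqP->.
have l1 : last 0%BZ s = 1%BZ.
  by rewrite (last_map Z_of_int P 0) -nth_last -lead_coefE (monicP monP).
have le_s : (size s <= 13)%N by rewrite size_map; case: (size P) leP.
case: (all_classified certificates_ok ss l1 le_s) => [ex|s_exc|cyc].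
(* A multiple of P vanishes at every root of P, which an excluded word forbids for Newman
   polynomials. *)
- case: (ex N newN) => g; rewrite -mapC_ipoly Ds DN rmorphM rootM => ->.
  by rewrite orbT.
- by rewrite -Ds map_f.
- case: ncyc; apply: is_cyclotomic_product_of_roots => // z.
  by rewrite -Ds mapC_ipoly; apply: cyc.
Qed.
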